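(* Let $(\mathcal A,G,\alpha)$ be a cleft C$^*$-dynamical system with commutative fixed point algebra $\mathcal B=\mathcal A^G$, and let $(\gamma,\omega)$ be an arbitrary factor system associated with it. Then $\mathcal A$ is commutative if and only if $\gamma_\pi(b)=b\otimes\mathbb 1_\pi$ and $\omega(\rho,\pi)=\sigma(\omega(\pi,\rho))$ for all $\pi,\rho\in\hat G$ and $b\in\mathcal B$, where $\sigma:\mathcal L(V_\pi)\otimes\mathcal L(V_\rho)\to\mathcal L(V_\rho)\otimes\mathcal L(V_\pi)$ denotes the tensor flip (extended by the identity on $\mathcal B$).
   Context: $G$ is a compact group. A representation $(\pi,V)$ of $G$ (space also written $V_\pi$) is finite-dimensional and unitary; $\hat G$ is the set of equivalence classes of irreducible representations (fix representatives), $1$ the trivial one. $\mathcal L(V)$ is the algebra of linear operators on $V$, $\mathbb 1_\pi$ the unit of $\mathcal L(V_\pi)$. Tensor products of C$^*$-algebras are minimal; elements and maps on a tensor factor are extended canonically (leg numbering $x_{12},y_{13}$). A C$^*$-dynamical system $(\mathcal A,G,\alpha)$ is a unital C$^*$-algebra $\mathcal A$ with an action $\alpha$ of $G$ by $*$-automorphisms, $g\mapsto\alpha_g(x)$ continuous for every $x\in\mathcal A$; $\mathcal B=\mathcal A^G$ is its fixed point algebra. For a representation $(\pi,V)$ put $A_2(\pi):=\{x\in\mathcal A\otimes\mathcal L(V):\pi_g\cdot\alpha_g(x)=x\ \forall g\in G\}$. The system is cleft if $A_2(\pi)$ contains a unitary element of $\mathcal A\otimes\mathcal L(V_\pi)$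 for every $\pi\in\hat G$. A non-degenerate isometry is an $s\in A_2(\pi)$ with $s^*s=\mathbb 1$ and $ss^*x=x$ for all $x\in A_2(\pi)$. Associated factor system: choose non-degenerate isometries $s_\pi\in A_2(\pi)$, $\pi\in\hat G$, with $s_1=\mathbb 1$. For an arbitrary representation $(\pi,V)$, decompose it into irreducibles $\sigma_k$ with isometric intertwiners $v_k:V_{\sigma_k}\to V$ and put $s_\pi:=\sum_kv_ks_{\sigma_k}v_k^*$ (independent of choices). The associated factor system $(\gamma,\omega)$ is $\gamma_\pi:\mathcal B\to\mathcal B\otimes\mathcal L(V_\pi)$, $\gamma_\pi(b)=s_\pi^*(b\otimes\mathbb 1_\pi)s_\pi$, and $\omega(\pi,\rho)=s_{\pi\otimes\rho}^*(s_\pi)_{12}(s_\rho)_{13}\in\mathcal B\otimes\mathcal L(V_\pi)\otimes\mathcal L(V_\rho)$ for $\pi,\rho\in\hat G$. A factor system associated with the dynamical system is one arising from some such choice. *)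

(* Defs.v *)
From HB Require Import structures.
From mathcomp Require Import all_boot all_order all_algebra.
From mathcomp Require Import sesquilinear spectral.
From mathcomp Require Import all_classical all_reals topology normedtype.
From mathcomp Require Import complex mxtens.

Set Implicit Arguments.
Unset Strict Implicit.
Unset Printing Implicit Defensive.
Import Order.TTheory GRing.Theory Num.Theory numFieldNormedType.Exports.
Local Open Scope classical_set_scope.
Local Open Scope ring_scope.
Local Open Scope sesquilinear_scope.

(* The type is numClosedFieldType so that the norm topology and the matrix
   topology are found on it: they are not found on [complex R] itself. *)
Definition Cplx (R : realType) : numClosedFieldType := complex R.

HB.mixin Record isTopologicalGroup G & Topological G & Group G := {
  mulg_continuous : continuous (fun gh : G * G => (gh.1 * gh.2)%g);
  invg_continuous : continuous (fun g : G => (g^-1)%g)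
}.
#[short(type="topGroupType")]
HB.structure Definition TopGroup :=
  {G of Topological G & Group G & isTopologicalGroup G}.

(* The norm is a field of the mixin, with values in R: joining algType with
   normedModType is rejected by Hierarchy-Builder, because numDomainType
   already inherits from ring and normed structures without a common join. *)
HB.mixin Record isCStarAlgebra (R : realType) A & GRing.Algebra (Cplx R) A := {
  star : A -> A;
  cnorm : A -> R;
  starK : involutive star;
  starD : {morph star : x y / x + y};
  starZ : forall (c : Cplx R) x, star (c *: x) = c^* *: star x;
  starM : forall x y, star (x * y) = star y * star x;
  cnorm0_eq0 : forall x, cnorm x = 0 -> x = 0;
  cnormD : forall x y, cnorm (x + y) <= cnorm x + cnorm y;
  cnormZ : forall (c : Cplx R) x, cnorm (c *: x) = complex.Re `|c| * cnorm x;
  cnormM : forall x y, cnorm (x * y) <= cnorm x * cnorm y;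
  cnorm_star : forall x, cnorm (star x * x) = cnorm x ^+ 2;
  cnorm_complete : forall u : nat -> A,
    (forall e : R, 0 < e -> exists N : nat, forall m n : nat,
       (N <= m)%N -> (N <= n)%N -> cnorm (u m - u n) < e) ->
    exists l : A, (fun n => cnorm (u n - l)) @ \oo --> (0 : R)
}.
#[short(type="cstarAlgType")]
HB.structure Definition CStarAlgebra R :=
  {A of GRing.Algebra (Cplx R) A & isCStarAlgebra R A}.

Record cstar_system (R : realType) (G : topGroupType) (A : cstarAlgType R) :=
  CStarSystem {
  act :> G -> {lrmorphism A -> A};
  act_star : forall g x, act g (star x) = star (act g x);
  act1 : forall x, act 1%g x = x;
  actM : forall g h x, act (g * h)%g x = act g (act h x);
  act_continuous : forall x g,
    (fun h => cnorm (act h x - act g x)) @ g --> (0 : R)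
}.

Definition fixed_points (R : realType) (G : topGroupType) (A : cstarAlgType R)
    (alpha : cstar_system G A) : set A :=
  [set b | forall g, alpha g b = b].

(* Representations act on V = C^rdim, viewed as column vectors. *)
Record urep (R : realType) (G : topGroupType) := URep {
  rdim : nat;
  rep :> G -> 'M[Cplx R]_rdim;
  rep_unitary : forall g, rep g \is unitarymx;
  rep1 : rep 1%g = 1%:M;
  repM : forall g h, rep (g * h)%g = rep g *m rep h;
  rep_continuous : continuous rep
}.

Section Representations.
Context {R : realType} {G : topGroupType}.
Implicit Types pi rho : urep R G.

Definition irreducible pi :=
  (0 < rdim pi)%N /\
  forall W : {vspace 'cV[Cplx R]_(rdim pi)},
    (forall g v, v \in W -> pi g *m v \in W) -> W = 0%VS \/ W = fullv.

Definition isometric_intertwiner pi rho (v : 'M[Cplx R]_(rdim rho, rdim pi)) :=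
  v ^t* *m v = 1%:M /\ forall g, rho g *m v = v *m pi g.

Definition equivalent pi rho :=
  exists2 v, @isometric_intertwiner pi rho v & v *m v ^t* = 1%:M.


Definition trivial_rep : urep R G.
Proof.
refine (@URep R G 1 (fun=> 1%:M) _ _ _ _).
- by move=> g; apply/unitarymxP; rewrite trmx1 map_mx1 mulmx1.
- by [].
- by move=> g h; rewrite mulmx1.
- exact: cst_continuous.
Defined.

Lemma tensmx11 (K : pzRingType) m n :
  (1%:M : 'M[K]_m) *t (1%:M : 'M[K]_n) = 1%:M.
Proof.
apply/matrixP => i j; case: (mxtens_indexP i) => i1 i2.
case: (mxtens_indexP j) => j1 j2; rewrite tensmxE !mxE -natrM mulnb.
by rewrite (can_eq (@mxtens_indexK _ _)) xpair_eqE.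
Qed.

Lemma tensmx_continuous pi rho : continuous (fun g => pi g *t rho g).
Proof.
have entry (sigma : urep R G) i j : continuous (fun g => rep sigma g i j).
  move=> g A /= nA.
  suff nS : nbhs (rep sigma g) [set M | A (M i j)].
    exact: (@rep_continuous _ _ sigma g _ nS).
  exists (fun k l => if (k == i) && (l == j) then A else setT).
    move=> k l; case: ifP => [/andP[/eqP-> /eqP->]//|_]; exact: filterT.
  by move=> M /(_ i j); rewrite !eqxx.
move=> g A [P nP PA].
rewrite /=.
suff : \forall h \near g, forall i j, P i j ((pi h *t rho h) i j).
  by apply: filterS => h; exact: PA.
apply: filter_forall => i; apply: filter_forall => j.
case: (mxtens_indexP i) (nP i j) => i1 i2.
case: (mxtens_indexP j) => j1 j2; rewrite tensmxE => nPij.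
have := cvgM (entry pi i1 j1 g) (entry rho i2 j2 g) => /(_ _ _ nPij).
by rewrite nbhs_simpl /=; apply: filterS => h /=; rewrite tensmxE.
Qed.

Definition tensor_rep pi rho : urep R G.
Proof.
refine (@URep R G (rdim pi * rdim rho) (fun g => pi g *t rho g) _ _ _
          (@tensmx_continuous pi rho)).
- move=> g; apply/unitarymxP.
  have -> : (pi g *t rho g) ^t* = (pi g) ^t* *t (rho g) ^t*.
    by rewrite trmx_tens map_mxT.
  rewrite tensmx_mul (unitarymxP (rep_unitary pi g)).
  by rewrite (unitarymxP (rep_unitary rho g)) tensmx11.
- by rewrite !rep1 tensmx11.
- by move=> g h; rewrite !repM tensmx_mul.
Defined.

End Representations.

(* A set of representatives of the equivalence classes of irreducible
   representations; [Irr0] is the index of the trivial class. *)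
Record irr_system (R : realType) (G : topGroupType) := IrrSystem {
  Irr : Type;
  irr : Irr -> urep R G;
  irr_irreducible : forall i, irreducible (irr i);
  irr_inj : forall i j, equivalent (irr i) (irr j) -> i = j;
  irr_surj : forall pi, irreducible pi -> exists i, equivalent pi (irr i);
  Irr0 : Irr;
  irr0_trivial : equivalent (irr Irr0) trivial_rep
}.
Coercion Irr : irr_system >-> Sortclass.

(* A (x) L(C^n) is 'M[A]_n, and (A (x) L(C^m)) (x) L(C^n) is 'M[A]_(m * n)
   through mxtens_index. *)
Section MatricesOverA.
Context {R : realType} {A : cstarAlgType R}.

Definition adjmx m n (x : 'M[A]_(m, n)) : 'M[A]_(n, m) := (map_mx star x)^T.

(* 1 (x) T *)
Definition one_tens m n (T : 'M[Cplx R]_(m, n)) : 'M[A]_(m, n) :=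
  map_mx (GRing.in_alg A) T.

Definition leg12 m n (x : 'M[A]_m) : 'M[A]_(m * n) := x *t (1%:M : 'M[A]_n).
Definition leg13 m n (y : 'M[A]_n) : 'M[A]_(m * n) := (1%:M : 'M[A]_m) *t y.

Definition flip_index m n (a : 'I_(n * m)) : 'I_(m * n) :=
  mxtens_index ((mxtens_unindex a).2, (mxtens_unindex a).1).
Definition tensor_flip m n (x : 'M[A]_(m * n)) : 'M[A]_(n * m) :=
  \matrix_(a, b) x (flip_index a) (flip_index b).

End MatricesOverA.

Section FactorSystems.
Context {R : realType} {G : topGroupType} {A : cstarAlgType R}.
Variables (alpha : cstar_system G A) (Ghat : irr_system R G).

Definition A2 (pi : urep R G) : set 'M[A]_(rdim pi) :=
  [set x | forall g, one_tens (pi g) *m map_mx (alpha g) x = x].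

Definition cleft := forall i : Ghat, exists u,
  [/\ A2 (pi := irr i) u, adjmx u *m u = 1%:M & u *m adjmx u = 1%:M].

Definition nondegenerate_isometry (pi : urep R G) (s : 'M[A]_(rdim pi)) :=
  [/\ A2 s, adjmx s *m s = 1%:M
    & forall x, A2 (pi := pi) x -> s *m adjmx s *m x = x].

Definition isometry_choice := forall i : Ghat, 'M[A]_(rdim (irr i)).

(* [t] is s_pi for some decomposition of pi into irreducible representations:
   the isometries v_k have orthogonal ranges spanning V_pi exactly when
   \sum_k v_k v_k^* = 1. *)
Definition extends_choice (s : isometry_choice) (pi : urep R G)
    (t : 'M[A]_(rdim pi)) :=
  exists (r : nat) (sigma : 'I_r -> Ghat)
         (v : forall k, 'M[Cplx R]_(rdim pi, rdim (irr (sigma k)))),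
    [/\ forall k, isometric_intertwiner (v k),
        \sum_k v k *m (v k) ^t* = 1%:M
      & t = \sum_k one_tens (v k) *m s (sigma k) *m one_tens ((v k) ^t*)].

(* gamma is only constrained on B = fixed_points alpha. The entries of
   gamma i b, for b in B, and of omega i j lie in B because
   alpha_g(s) = pi_g^* s for s in A2(pi). *)
Definition associated_factor_system
    (gamma : forall i : Ghat, A -> 'M[A]_(rdim (irr i)))
    (omega : forall i j : Ghat, 'M[A]_(rdim (irr i) * rdim (irr j))) :=
  exists s : isometry_choice,
    [/\ forall i, nondegenerate_isometry (s i),
        s (Irr0 Ghat) = 1%:M,
        forall i b, fixed_points alpha b ->
          gamma i b = adjmx (s i) *m b%:M *m s i
      & forall i j, exists2 t,
          extends_choice s (pi := tensor_rep (irr i) (irr j)) t &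
          omega i j = adjmx t *m leg12 (rdim (irr j)) (s i)
                              *m leg13 (rdim (irr i)) (s j)].

End FactorSystems.

(* Main.v *)
(* If A is commutative, everything follows from the fact that s_pi does not
   depend on the decomposition of pi (Schur's lemma), so that the tensor flip
   maps s_(pi (x) rho) to s_(rho (x) pi).

   Conversely, cleftness makes every s_pi unitary. Then gamma_pi(b) = b (x) 1
   says that the entries of s_pi commute with B, and the symmetry of omega says
   that the entries of s_pi and s_rho commute with each other. Every x in A_2(pi)
   is s_pi (s_pi^* x) with s_pi^* x over B, so the entries of the elements of all
   A_2(pi) commute. Their span is dense in A by the following form of the
   Peter-Weyl theorem. The Haar mean of a continuous function is the constant
   approximated by averages of finitely many of its translates. A symmetric
   continuous real function psi on G is, up to an error that is small as a
   convolution operator, a finite sum of psi * e_k with idempotents e_k: the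
   first one is the limit of the normalised even powers of psi, and subtracting
   psi * e_k lowers the L^2 norm by a fixed amount. The functions f with
   f * e_k = f form a finite-dimensional translation-invariant space, that is an
   orthogonal representation of G, and integrating a basis of it along the orbit
   of x yields elements of the A_2(pi). *)
Require Import Defs.
From HB Require Import structures.
From mathcomp Require Import all_boot all_order all_algebra.
From mathcomp Require Import all_classical all_reals topology normedtype.
From mathcomp Require Import sequences sesquilinear spectral complex mxtens.
From mathcomp Require Import zify ring lra.

Set Implicit Arguments.
Unset Strict Implicit.
Unset Printing Implicit Defensive.
Import Order.TTheory GRing.Theory Num.Theory numFieldNormedType.Exports.
Local Open Scope classical_set_scope.
Local Open Scope ring_scope.

(** There is no completion for the inner product [dot] on continuous functions, so limits that are
    Cauchy only for [dot] must be made uniform. A spare convolution factor does this, since the sup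
    norm of [f ** k] is bounded by the [dot] norms of [f] and [k]. The same device returns in the
    density proof: [psi] is approximated only as a convolution operator, and the second factor of
    [psi ** psi] turns this into a small integral. Functions are real because a kernel with
    [cinv psi = psi] already acts self-adjointly; scalars become complex when a function is
    integrated against [A]. Estimates along an orbit need isometric automorphisms, which the
    C*-identity yields through unitaries. Finally, [omega i j] and [omega j i] may come from
    unrelated decompositions, so the uniqueness of [s_pi] serves both directions of the
    equivalence. *)

(** * Continuity and compactness on topological groups *)

Section TopGroup.
Context {G : topGroupType}.

Lemma continuous_comp2 (S T U V : topologicalType) (f : S -> T) (g : S -> U)
    (h : T * U -> V) :
  continuous f -> continuous g -> continuous h ->
  continuous (fun x => h (f x, g x)).
Proof.
move=> cf cg ch x.
apply: (@continuous_comp _ _ _ (fun x => (f x, g x)) h); last exact: ch.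
by apply: cvg_pair; [exact: cf | exact: cg].
Qed.

Lemma mulg_continuous2 (T : topologicalType) (f g : T -> G) :
  continuous f -> continuous g -> continuous (fun x => (f x * g x)%g).
Proof. by move=> cf cg; exact: (continuous_comp2 cf cg (@mulg_continuous G)). Qed.

Lemma invg_continuous1 (T : topologicalType) (f : T -> G) :
  continuous f -> continuous (fun x => (f x)^-1%g).
Proof.
by move=> cf x; apply: continuous_comp; [exact: cf | exact: invg_continuous].
Qed.

Lemma continuous_id (T : topologicalType) : continuous (@id T).
Proof. by move=> x; exact: cvg_id. Qed.

Lemma continuous_fst (T U : topologicalType) : continuous (@fst T U).
Proof. by move=> [x y]; exact: cvg_fst. Qed.

Lemma continuous_snd (T U : topologicalType) : continuous (@snd T U).
Proof. by move=> [x y]; exact: cvg_snd. Qed.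

Lemma nbhs_translate (V : set G) (x : G) :
  nbhs (1%g : G) V -> nbhs x [set u | V (u * x^-1)%g].
Proof.
move=> nV.
have := @mulg_continuous2 _ id (cst x^-1%g) (@continuous_id _)
  (@cst_continuous _ _ _) x.
by apply; rewrite /= mulgV.
Qed.

Context {R : realType} (cG : compact [set: G]).

(** The tube lemma: a box around each [(t0, x)] gives the estimate near [x], and the near-covering
    form of compactness merges these over [G]. *)
Lemma compact_continuous_uniform (T : topologicalType) (F : T * G -> R) (t0 : T)
    (e : R) :
  continuous F -> 0 < e ->
  \forall t \near t0, forall g, `|F (t, g) - F (t0, g)| < e.
Proof.
move=> cF e0.
have nc : near_covering [set: G] by apply/compact_near_coveringP.
have K := nc T (nbhs t0) (fun t g => `|F (t, g) - F (t0, g)| < e)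
  (nbhs_filter t0).
suff /K : forall x, [set: G] x ->
    \forall g \near x & t \near nbhs t0, `|F (t, g) - F (t0, g)| < e.
  by apply: filterS => t Pt g; exact: Pt.
move=> x _; have e2 : 0 < e / 2 by rewrite divr_gt0.
have /cvgrPdist_lt/(_ _ e2) := cF (t0, x).
move=> [[P Q] /= [nP nQ] PQ].
exists (Q, P) => //= -[g t] /= [Qg Pt].
have h1 := PQ (t, g) (conj Pt Qg).
have h2 := PQ (t0, g) (conj (nbhs_singleton nP) Qg).
rewrite (splitr e) (le_lt_trans (ler_distD (F (t0, x)) _ _)) // ltrD //.
by rewrite distrC.
Qed.

(** Near-covering along the filter of lists ordered by inclusion turns a list that is good near each
    point into one good everywhere. It is non-empty because it covers [1]; averages divide by its
    length. *)
Lemma compact_finite_cover (V : G -> set G) : (forall x, nbhs x (V x)) ->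
  exists2 T : seq G, T != [::] & forall u, exists2 t, t \in T & V t u.
Proof.
move=> nV.
pose F : set_system (seq G) :=
  filter_from [set: seq G] (fun l0 => [set l : seq G | {subset l0 <= l}]).
have FF : Filter F.
  apply: filter_from_filter; first by exists [::].
  move=> i j _ _; exists (i ++ j) => // l /= sl; split => x xl; apply: sl.
    by rewrite mem_cat xl.
  by rewrite mem_cat xl orbT.
have nc : near_covering [set: G] by apply/compact_near_coveringP.
have K := nc _ F (fun l u => exists2 t, t \in l & V t u) FF.
suff /K [l0 _ Hl0] : forall x, [set: G] x ->
    \forall u \near x & l \near F, exists2 t, t \in l & V t u.
  exists l0; last by move=> u; apply: (Hl0 l0) => //=.
  have [t tl _] := Hl0 l0 (fun _ h => h) 1%g I.
  by apply: contraTneq tl => ->.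
move=> x _.
exists (V x, [set l : seq G | x \in l]).
  by split => //; exists [:: x] => //= l; apply; exact: mem_head.
by move=> [u l] [/= Vu xl]; exists x.
Qed.

Lemma finite_translates (V : set G) : nbhs (1%g : G) V ->
  exists2 T : seq G, T != [::] & forall u, exists2 t, t \in T & V (u * t^-1)%g.
Proof.
by move=> nV; apply: (@compact_finite_cover (fun t => [set u | V (u * t^-1)%g]));
  move=> x; exact: nbhs_translate.
Qed.

Lemma compact_continuous_bounded (f : G -> R) :
  continuous f -> exists C : R, forall u, `|f u| <= C.
Proof.
move=> cf.
have n1 x : nbhs x [set u | `|f x - f u| < 1].
  by have /cvgrPdist_lt/(_ _ ltr01) := cf x.
have [T _ HT] := compact_finite_cover n1.
exists (\sum_(t <- T) (`|f t| + 1)) => u.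
have [t tT /= ft] := HT u.
rewrite (big_rem t) //= ler_wpDr //.
  by apply: sumr_ge0 => i _; rewrite addr_ge0.
have := ler_distD (f t) (f u) 0; rewrite !subr0 => /le_trans->//.
by rewrite addrC lerD2l distrC ltW.
Qed.

End TopGroup.

(** * Invariant mean on a compact group *)

Section Averages.
Context {R : realType} {G : topGroupType}.
Implicit Types (f h : G -> R) (l m : seq G) (u : G).

Definition ravg l f u := (size l)%:R^-1 * \sum_(a <- l) f (u * a)%g.
Definition lavg l f u := (size l)%:R^-1 * \sum_(a <- l) f (a * u)%g.

Lemma size_neq0 l : l != [::] -> (size l)%:R != 0 :> R.
Proof. by rewrite pnatr_eq0 size_eq0. Qed.

Lemma sumr_const_seq (T : Type) (s : seq T) (c : R) :
  \sum_(a <- s) c = (size s)%:R * c.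
Proof.
by rewrite big_const_seq count_predT iter_addr_0 mulr_natl.
Qed.

Lemma ravg_ge l f c : l != [::] -> (forall u, c <= f u) ->
  forall u, c <= ravg l f u.
Proof.
move=> l0 cf u; have l1 := size_neq0 l0.
rewrite /ravg ler_pdivlMl ?lt0r ?l1 ?ler0n //.
rewrite -sumr_const_seq.
by apply: ler_sum => i _.
Qed.

Lemma ravgN l f u : ravg l (fun u => - f u) u = - ravg l f u.
Proof. by rewrite /ravg sumrN mulrN. Qed.

Lemma ravg_le l f c : l != [::] -> (forall u, f u <= c) ->
  forall u, ravg l f u <= c.
Proof.
move=> l0 cf u; rewrite -lerN2 -ravgN; apply: ravg_ge => // v.
by rewrite lerN2.
Qed.

Lemma ravg_inv l f u :
  ravg l (fun g => f g^-1%g) u = lavg [seq a^-1%g | a <- l] f u^-1%g.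
Proof.
rewrite /ravg /lavg size_map big_map; congr (_ * _).
by apply: eq_bigr => a _; rewrite invgM.
Qed.

Lemma lravgC l m f u : lavg l (ravg m f) u = ravg m (lavg l f) u.
Proof.
rewrite /lavg /ravg -!mulr_sumr mulrCA; congr (_ * (_ * _)).
by rewrite exchange_big; apply: eq_bigr => i _; apply: eq_bigr => j _; rewrite mulgA.
Qed.

Lemma ravg_comp l m f u :
  ravg l (ravg m f) u = ravg [seq (a * b)%g | a <- l, b <- m] f u.
Proof.
rewrite /ravg -mulr_sumr mulrA size_allpairs natrM invfM; congr (_ * _).
rewrite big_allpairs_dep; apply: eq_bigr => i _; apply: eq_bigr => j _.
by rewrite mulgA.
Qed.

Lemma allpairs_neq0 l m : l != [::] -> m != [::] ->
  [seq (a * b)%g | a <- l, b <- m] != [::].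
Proof.
rewrite -!size_eq0 size_allpairs muln_eq0 => /negbTE-> /negbTE->; by [].
Qed.

Definition is_rmean f c := forall e, 0 < e ->
  exists2 l, l != [::] & forall u, `|ravg l f u - c| <= e.
Definition is_lmean f c := forall e, 0 < e ->
  exists2 l, l != [::] & forall u, `|lavg l f u - c| <= e.

Lemma ravg_dist l f c e : l != [::] -> (forall u, `|f u - c| <= e) ->
  forall u, `|ravg l f u - c| <= e.
Proof.
move=> l0 fc u; rewrite ler_distl; apply/andP; split.
  by apply: ravg_ge => // v; have := fc v; rewrite ler_distl => /andP[].
by apply: ravg_le => // v; have := fc v; rewrite ler_distl => /andP[].
Qed.

Lemma lavg_dist l f c e : l != [::] -> (forall u, `|f u - c| <= e) ->
  forall u, `|lavg l f u - c| <= e.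
Proof.
move=> l0 fc u.
have -> : lavg l f u = ravg [seq a^-1%g | a <- l] (fun g => f g^-1%g) u^-1%g.
  rewrite ravg_inv mapK; last exact: invgK.
  by rewrite invgK.
by apply: ravg_dist => //; rewrite -size_eq0 size_map size_eq0.
Qed.

Lemma is_mean_inv f c : is_rmean (fun g => f g^-1%g) c <-> is_lmean f c.
Proof.
split=> H e /H[l l0 Hl]; exists [seq a^-1%g | a <- l];
  rewrite -?size_eq0 ?size_map ?size_eq0 // => u.
  by rewrite -[u]invgK -ravg_inv.
by rewrite ravg_inv mapK; [exact: Hl | exact: invgK].
Qed.

(** Left and right translations commute, so a double average can be taken in either order and lies
    close to both constants. *)
Lemma mean_unique f c d : is_rmean f c -> is_lmean f d -> c = d.
Proof.
move=> Hc Hd; apply/eqP; rewrite -subr_eq0 -normr_le0; apply/ler_addgt0Pr => e e0.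
have e2 : 0 < e / 2 by rewrite divr_gt0.
have [l l0 Hl] := Hc _ e2; have [m m0 Hm] := Hd _ e2.
have H1 := lavg_dist m0 Hl 1%g; have H2 := ravg_dist l0 Hm 1%g.
rewrite lravgC in H1; rewrite add0r (splitr e).
rewrite (le_trans (ler_distD (ravg l (lavg m f) 1%g) _ _)) // lerD //.
by rewrite distrC.
Qed.

Context (cG : compact [set: G]).

(* Wherever an average is below its upper bound [B] by [e], averaging it over
   translates that move this place around [G] lowers the bound by a fixed
   amount [e / (2 * size T)]; this can only happen finitely often. *)
Lemma ravg_osc f e : continuous f -> 0 < e ->
  exists l, l != [::] /\ exists B, forall u, B - e <= ravg l f u <= B.
Proof.
move=> cf e0; have e2 : 0 < e / 2 by rewrite divr_gt0.
have cF : continuous (fun p : G * G => f (p.1 * p.2)%g).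
  move=> p; apply: continuous_comp; last exact: cf.
  exact: mulg_continuous.
pose V : set G := fun t => forall g, `|f (t * g)%g - f (1 * g)%g| < e / 2.
have nV : nbhs (1%g : G) V := compact_continuous_uniform cG 1%g cF e2.
have [T T0 HT] := finite_translates cG nV.
have T1 := size_neq0 T0; have Tpos : 0 < (size T)%:R :> R by rewrite lt0r T1 ler0n.
have [C HC] := compact_continuous_bounded cG cf.
pose d := e / 2 / (size T)%:R.
have d0 : 0 < d by rewrite divr_gt0.
(* [V] measures left translation, so right averages inherit the modulus whatever [l] is. *)
have unif l : l != [::] -> forall v s, V v -> ravg l f (v * s)%g <= ravg l f s + e / 2.
  move=> l0 v s Vv; rewrite -lerBlDl.
  have -> : ravg l f (v * s)%g - ravg l f s =
     ravg l (fun u => f (v * s * s^-1 * u)%g - f u) s.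
    rewrite /ravg -mulrBr -sumrB; congr (_ * _); apply: eq_bigr => a _.
    by rewrite mulgK mulgA.
  apply: ravg_le => // u; rewrite mulgK.
  have := Vv u; rewrite /= mul1g => /ltW; apply: le_trans; exact: ler_norm.
(* Each round lowers the bound by [d], starting from [C]; no average goes below [-C], so [k] rounds
   suffice once [B + C <= k * d]. *)
suff H k : forall l B, l != [::] -> (forall u, ravg l f u <= B) ->
    B + C <= k%:R * d -> exists l', l' != [::] /\
      exists B, forall u, B - e <= ravg l' f u <= B.
  apply: (H (Num.truncn (2 * C / d)).+1 [:: 1%g] C) => //.
    by apply: ravg_le => // u; apply: le_trans (HC u); exact: ler_norm.
  have := truncnS_gt (2 * C / d).
  by rewrite ltr_pdivrMr // mulr_natl mulr2n => /ltW.
elim: k => [|k IH] l B l0 HB.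
  rewrite mul0r => BC; exists l; split => //.
  exists B => u; rewrite HB andbT (@le_trans _ _ (-C)) //.
    by rewrite lerBlDr; move: BC e0; lra.
  by apply: ravg_ge => // v; have := HC v; rewrite ler_norml => /andP[].
move=> Bk.
have [osc|] := pselect (forall u, B - e <= ravg l f u).
  by exists l; split => //; exists B => u; rewrite osc HB.
move=> /existsNP[s0 /negP]; rewrite -ltNge => Hs0.
(* For every [u] some [t] has [u * t^-1] in [V]; then the average at [u * t^-1 * s0] is at most
   [e / 2] above its low value at [s0]. *)
pose m := [seq (t^-1 * s0)%g | t <- T].
have m0 : m != [::] by rewrite -size_eq0 size_map size_eq0.
apply: (IH [seq (a * b)%g | a <- m, b <- l] (B - d)).
- exact: allpairs_neq0.
- move=> u; rewrite -ravg_comp {1}/ravg size_map big_map.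
  have [t tT Vt] := HT u.
  rewrite ler_pdivrMl // (big_rem t) //=.
  have -> : (size T)%:R * (B - d) = (B - e / 2) + (size T).-1%:R * B.
    rewrite mulrBr [_ * d]mulrC divfK //.
    have -> : (size T)%:R = 1 + (size T).-1%:R :> R.
      by rewrite -(natrD _ 1) add1n prednK // lt0n size_eq0.
    by ring.
  apply: lerD.
    have := unif l l0 _ s0 Vt.
    rewrite -!mulgA => /le_trans; apply.
    by rewrite -lerBrDr -addrA -opprD -splitr ltW.
  rewrite -(size_rem tT) -sumr_const_seq.
  by apply: ler_sum => i _.
- by rewrite addrAC lerBlDr (le_trans Bk) // -natr1 mulrDl mul1r.
Qed.

End Averages.

(** * The real vector space of continuous functions and its mean *)

Section ContinuousFunctions.
Context {R : realType} {G : topGroupType}.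

Definition cont_pred : {pred G -> R^o} := fun f => `[< continuous f >].

Lemma cont_pred_submod : submod_closed cont_pred.
Proof.
split; first by apply/asboolP; exact: cst_continuous.
move=> a f h /asboolP cf /asboolP ch; apply/asboolP => x.
by apply: (@cvgD _ R^o); [apply: (@cvgZ _ R^o); [exact: cvg_cst|exact: cf]|exact: ch].
Qed.
HB.instance Definition _ :=
  GRing.isSubmodClosed.Build R (G -> R^o) cont_pred cont_pred_submod.

Record cfun := CFun { cfun_fun : G -> R^o; cfun_in : cfun_fun \in cont_pred }.
HB.instance Definition _ := [isSub for cfun_fun].
HB.instance Definition _ := [Choice of cfun by <:].
HB.instance Definition _ := [SubChoice_isSubLmodule of cfun by <:].

Definition cfun_val (f : cfun) : G -> R := cfun_fun f.
Coercion cfun_val : cfun >-> Funclass.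

Lemma cfun_continuous (f : cfun) : continuous (f : G -> R).
Proof. by apply/asboolP; exact: cfun_in. Qed.

Definition mk_cfun (f : G -> R) (cf : continuous f) : cfun :=
  CFun (introT (asboolP (continuous (f : G -> R^o))) cf).

Lemma cfunP (f h : cfun) : f =1 h -> f = h.
Proof. by move=> fh; apply: val_inj; apply/funext. Qed.

Lemma cfun0E u : (0 : cfun) u = 0. Proof. by []. Qed.
Lemma cfunDE (f h : cfun) u : (f + h) u = f u + h u. Proof. by []. Qed.
Lemma cfunNE (f : cfun) u : (- f) u = - f u. Proof. by []. Qed.
Lemma cfunBE (f h : cfun) u : (f - h) u = f u - h u. Proof. by []. Qed.
Lemma cfunZE a (f : cfun) u : (a *: f) u = a * f u. Proof. by []. Qed.
Lemma cfun_sumE I (r : seq I) (P : pred I) (F : I -> cfun) u :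
  (\sum_(i <- r | P i) F i) u = \sum_(i <- r | P i) F i u.
Proof.
by elim/big_rec2: _ => [|i _ f _ <-] //; rewrite cfunDE.
Qed.
End ContinuousFunctions.
Arguments cfun R G : clear implicits.

Section CFunOperations.
Context {R : realType} {G : topGroupType}.
Implicit Types (f h : cfun R G).

Lemma continuous_mulr (T : topologicalType) (f h : T -> R) :
  continuous f -> continuous h -> continuous (fun u => f u * h u).
Proof. by move=> cf ch x; apply: cvgM; [exact: cf|exact: ch]. Qed.

Lemma continuous_norm (T : topologicalType) (f : T -> R) :
  continuous f -> continuous (fun u => `|f u|).
Proof. by move=> cf x; apply: cvg_norm; exact: cf. Qed.

Lemma continuous_comp1 (S T U : topologicalType) (f : S -> T) (h : T -> U) :
  continuous f -> continuous h -> continuous (fun x => h (f x)).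
Proof. by move=> cf ch x; apply: continuous_comp; [exact: cf|exact: ch]. Qed.

Definition ccst (c : R) : cfun R G :=
  mk_cfun (@cst_continuous G R c).
Definition cmul f h : cfun R G :=
  mk_cfun (continuous_mulr (@cfun_continuous _ _ f) (@cfun_continuous _ _ h)).
Definition cabs f : cfun R G :=
  mk_cfun (continuous_norm (@cfun_continuous _ _ f)).
Definition ltrans a f : cfun R G :=
  mk_cfun (continuous_comp1
    (mulg_continuous2 (@cst_continuous G G a) (@continuous_id G))
    (@cfun_continuous _ _ f)).
Definition rtrans a f : cfun R G :=
  mk_cfun (continuous_comp1
    (mulg_continuous2 (@continuous_id G) (@cst_continuous G G a))
    (@cfun_continuous _ _ f)).
Definition cinv f : cfun R G :=
  mk_cfun (continuous_comp1 (@invg_continuous G) (@cfun_continuous _ _ f)).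

Lemma ccstE c u : ccst c u = c. Proof. by []. Qed.
Lemma cmulE f h u : cmul f h u = f u * h u. Proof. by []. Qed.
Lemma cabsE f u : cabs f u = `|f u|. Proof. by []. Qed.
Lemma ltransE a f u : ltrans a f u = f (a * u)%g. Proof. by []. Qed.
Lemma rtransE a f u : rtrans a f u = f (u * a)%g. Proof. by []. Qed.
Lemma cinvE f u : cinv f u = f u^-1%g. Proof. by []. Qed.

Lemma cinvK : involutive cinv.
Proof. by move=> f; apply: cfunP => u; rewrite !cinvE invgK. Qed.

Lemma cfun_ravg l f : exists h, h =1 ravg l f.
Proof.
exists ((size l)%:R^-1 *: \sum_(a <- l) rtrans a f) => u.
by rewrite cfunZE cfun_sumE.
Qed.

End CFunOperations.

Section Mean.
Context {R : realType} {G : topGroupType} (cG : compact [set: G]).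
Implicit Types (f h : cfun R G).

(** [xget] keeps the compactness proof out of the arguments; for compact [G] the default 0 is never
    taken, by [exists_rmean]. *)
Definition mean f : R := xget 0 [set c | is_rmean f c].

(** The value is the infimum of the upper bounds of right averages. A left average of small
    oscillation commutes with all right averages, so none of them can lie far below it; this bounds
    the infimum from below. *)
Lemma exists_rmean f : exists c, is_rmean f c.
Proof.
pose S := [set B | exists2 l, l != [::] & forall u, ravg l f u <= B].
have [C HC] := compact_continuous_bounded cG (@cfun_continuous _ _ f).
have cf := @cfun_continuous _ _ f; have ci := @cfun_continuous _ _ (cinv f).
have HS : has_inf S.
  split.
    exists C, [:: 1%g] => // u; apply: ravg_le => // v.
    by apply: le_trans (HC v); exact: ler_norm.
  exists (- C) => B [l l0 lB]; apply: le_trans (lB 1%g); apply: ravg_ge => // v.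
  by have := HC v; rewrite ler_norml => /andP[].
exists (inf S) => e e0; have e2 : 0 < e / 2 by rewrite divr_gt0.
have [l [l0 [B HB]]] := ravg_osc cG cf e2.
have [m' [m'0 [B2 HB2']]] := ravg_osc cG ci e2.
have [m m0 HB2] : exists2 m, m != [::] & forall u, B2 - e / 2 <= lavg m f u <= B2.
  exists [seq a^-1%g | a <- m'].
    by rewrite -size_eq0 size_map size_eq0.
  by move=> u; rewrite -[u]invgK -ravg_inv; exact: HB2'.
exists l => // u.
have cB : inf S <= B by apply: ge_inf; [case: HS|exists l => // v; case/andP: (HB v)].
have Bc : B2 - e / 2 <= inf S.
  apply: lb_le_inf; first by case: HS.
  move=> B' [l' l'0 HB'].
  have lav v : lavg m (ravg l' f) v = ravg l' (lavg m f) v by exact: lravgC.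
  have : ravg l' (lavg m f) 1%g >= B2 - e / 2.
    by apply: ravg_ge => // v; case/andP: (HB2 v).
  rewrite -lav => /le_trans; apply.
  rewrite -[1%g]invgK -[m](mapK (@invgK G)) -ravg_inv.
  apply: ravg_le => [|v]; last exact: HB'.
  by rewrite -size_eq0 size_map size_eq0.
have BB : B - e / 2 <= B2.
  have := lravgC m l f 1%g; have : ravg l (lavg m f) 1%g <= B2.
    by apply: ravg_le => // v; case/andP: (HB2 v).
  move=> + H; rewrite -H; apply: le_trans.
  rewrite -[1%g]invgK -[m](mapK (@invgK G)) -ravg_inv.
  apply: ravg_ge => [|v]; last by case/andP: (HB v^-1%g).
  by rewrite -size_eq0 size_map size_eq0.
have /andP[h1 h2] := HB u.
rewrite ler_distl; apply/andP; split; move: cB Bc BB h1 h2; lra.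
Qed.

Lemma mean_rmean f : is_rmean f (mean f).
Proof. by have [c fc] := exists_rmean f; exact: (xgetPex 0 (exists_rmean f)). Qed.

Lemma mean_lmean f : is_lmean f (mean f).
Proof.
have /is_mean_inv H := mean_rmean (cinv f).
by rewrite (mean_unique (mean_rmean f) H).
Qed.

Lemma mean_eq f c : is_rmean f c -> mean f = c.
Proof. by move=> H; rewrite (mean_unique H (mean_lmean f)). Qed.

Lemma mean_eql f c : is_lmean f c -> mean f = c.
Proof. by move=> H; rewrite (mean_unique (mean_rmean f) H). Qed.

(** Lists are composed: averaging a good average again keeps its error, and a right average of [f]
    has the same mean as [f], so the next function can be treated without spoiling the earlier
    ones. *)
Lemma mean_simultaneous (s : seq (cfun R G)) e : 0 < e ->
  exists2 l, l != [::] & forall f, f \in s -> forall u, `|ravg l f u - mean f| <= e.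
Proof.
move=> e0; elim: s => [|f s [l l0 Hl]]; first by exists [:: 1%g].
have [h Hh] := cfun_ravg l f.
have Em : mean h = mean f.
  apply: mean_eql => d d0; have [m m0 Hm] := mean_lmean f d0.
  exists m => // u; have -> : lavg m h u = ravg l (lavg m f) u.
    by rewrite -lravgC; congr (_ * _); apply: eq_bigr => a _; rewrite Hh.
  exact: ravg_dist.
have [m m0 Hm] := mean_rmean h e0.
exists [seq (a * b)%g | a <- m, b <- l]; first exact: allpairs_neq0.
move=> k; rewrite inE => /predU1P[->|ks] u; rewrite -ravg_comp.
  have := Hm u; rewrite Em; congr (`|_ - _| <= _).
  by congr (_ * _); apply: eq_bigr => a _; rewrite Hh.
by apply: ravg_dist => // v; exact: Hl.
Qed.

Lemma mean_cst c : mean (ccst c) = c.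
Proof.
apply: mean_eq => e e0; exists [:: 1%g] => // u.
apply: (@ravg_dist R G [:: 1%g]) => // v; rewrite ccstE subrr normr0 ltW //.
Qed.

Lemma meanD f h : mean (f + h) = mean f + mean h.
Proof.
apply: mean_eq => e e0; have e2 : 0 < e / 2 by rewrite divr_gt0.
have [l l0 Hl] := mean_simultaneous [:: f; h] e2; exists l => // u.
have -> : ravg l (f + h) u - (mean f + mean h) =
    (ravg l f u - mean f) + (ravg l h u - mean h).
  rewrite {1}/ravg (eq_bigr (fun a => f (u * a)%g + h (u * a)%g)) //.
  by rewrite big_split /= mulrDr -/(ravg l f u) -/(ravg l h u); ring.
by rewrite (splitr e) (le_trans (ler_normD _ _)) // lerD // Hl // !inE eqxx ?orbT.
Qed.

Lemma meanZ a f : mean (a *: f) = a * mean f.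
Proof.
apply: mean_eq => e e0.
have a0 : 0 < `|a| + 1 by rewrite ltr_wpDl.
have e2 : 0 < e / (`|a| + 1) by rewrite divr_gt0.
have [l l0 Hl] := mean_rmean f e2; exists l => // u.
have -> : ravg l (a *: f) u - a * mean f = a * (ravg l f u - mean f).
  rewrite {1}/ravg (eq_bigr (fun b => a * f (u * b)%g)) //.
  by rewrite -mulr_sumr /ravg; ring.
rewrite normrM (@le_trans _ _ ((`|a| + 1) * (e / (`|a| + 1)))) //.
  by rewrite ler_pM // lerDl.
by rewrite mulrC divfK ?gt_eqF.
Qed.

Lemma meanN f : mean (- f) = - mean f.
Proof. by rewrite -scaleN1r meanZ mulN1r. Qed.

Lemma meanB f h : mean (f - h) = mean f - mean h.
Proof. by rewrite meanD meanN. Qed.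

Lemma mean0 : mean 0 = 0.
Proof. by rewrite -(scale0r 0) meanZ mul0r. Qed.

Lemma mean_sum I (r : seq I) (P : pred I) (F : I -> cfun R G) :
  mean (\sum_(i <- r | P i) F i) = \sum_(i <- r | P i) mean (F i).
Proof. exact: (big_morph mean meanD mean0). Qed.

Lemma mean_ge0 f : (forall u, 0 <= f u) -> 0 <= mean f.
Proof.
move=> f0; apply/ler_addgt0Pr => e e0; have [l l0 Hl] := mean_rmean f e0.
have := Hl 1%g; have := @ravg_ge R G l f 0 l0 f0 1%g.
by rewrite ler_distl => ? /andP[? ?]; lra.
Qed.

Lemma mean_le f h : (forall u, f u <= h u) -> mean f <= mean h.
Proof.
move=> fh; rewrite -subr_ge0 -meanB; apply: mean_ge0 => u.
by rewrite cfunBE subr_ge0.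
Qed.

Lemma mean_abs f : `|mean f| <= mean (cabs f).
Proof.
rewrite ler_norml -meanN; apply/andP; split; apply: mean_le => u.
  by rewrite cfunNE cabsE lerNl -normrN ler_norm.
exact: ler_norm.
Qed.

Lemma mean_bounded f c : (forall u, `|f u| <= c) -> `|mean f| <= c.
Proof.
move=> fc; rewrite (le_trans (mean_abs _)) // -[c](mean_cst); exact: mean_le.
Qed.

Lemma mean_ltrans a f : mean (ltrans a f) = mean f.
Proof.
apply: mean_eq => e e0; have [l l0 Hl] := mean_rmean f e0; exists l => // u.
have -> // : ravg l (ltrans a f) u = ravg l f (a * u)%g.
by congr (_ * _); apply: eq_bigr => b _; rewrite ltransE mulgA.
Qed.

Lemma mean_rtrans a f : mean (rtrans a f) = mean f.
Proof.
apply: mean_eql => e e0; have [l l0 Hl] := mean_lmean f e0; exists l => // u.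
have -> // : lavg l (rtrans a f) u = lavg l f (u * a)%g.
by congr (_ * _); apply: eq_bigr => b _; rewrite rtransE mulgA.
Qed.

Lemma mean_inv f : mean (cinv f) = mean f.
Proof.
by apply: mean_eql; apply/is_mean_inv => e /(mean_rmean f)[l l0 Hl];
  exists l => // u; rewrite /ravg; under eq_bigr do rewrite cinvE invgK; exact: Hl.
Qed.

(* Finitely many translates of [f] add up to a function bounded below by [f u0 / 2]. *)
Lemma mean_gt0 f u0 : (forall u, 0 <= f u) -> 0 < f u0 -> 0 < mean f.
Proof.
move=> f0 fu0; have e2 : 0 < f u0 / 2 by rewrite divr_gt0.
pose V x := [set u | f u0 / 2 < f (u * x^-1 * u0)%g].
have nV x : nbhs x (V x).
  have cf : continuous (fun u => f (u * x^-1 * u0)%g).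
    apply: continuous_comp1; last exact: cfun_continuous.
    apply: mulg_continuous2; last exact: cst_continuous.
    by apply: mulg_continuous2; [exact: continuous_id|exact: cst_continuous].
  have /cvgrPdist_lt/(_ _ e2) := cf x.
  apply: filterS => u /=; rewrite mulgV mul1g ltr_distlC => /andP[+ _].
  by rewrite ltrBlDr -ltrBlDl /V /=; lra.
have [T T0 HT] := compact_finite_cover cG nV.
have := @mean_le (ccst (f u0 / 2)) (\sum_(t <- T) rtrans (t^-1 * u0)%g f).
rewrite mean_cst mean_sum (eq_bigr (fun=> mean f)); last first.
  by move=> t _; rewrite mean_rtrans.
rewrite sumr_const_seq => H; have {}H : f u0 / 2 <= (size T)%:R * mean f.
  apply: H => u; rewrite ccstE cfun_sumE; have [t tT Vt] := HT u.
  rewrite (big_rem t) //= ler_wpDr //; first by apply: sumr_ge0 => ? _; exact: f0.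
  by have := ltW Vt; rewrite -mulgA.
have := lt_le_trans e2 H; rewrite pmulr_rgt0 // lt0r size_neq0 //= ler0n //.
Qed.

End Mean.

(** * Convolution *)

Section Convolution.
Context {R : realType} {G : topGroupType} (cG : compact [set: G]).
Implicit Types (f h k : cfun R G).

Definition section_fun (F : G * G -> R) (cF : continuous F) (s : G) : cfun R G :=
  mk_cfun (continuous_comp2 (@cst_continuous G G s) (@continuous_id G) cF).

Lemma continuous_mean (F : G * G -> R) (cF : continuous F) :
  continuous (fun s => mean (section_fun cF s) : R).
Proof.
move=> s; apply/cvgrPdist_le => e e0.
apply: filterS (compact_continuous_uniform cG s cF e0) => t Ht.
rewrite distrC -meanB //; apply: mean_bounded => // u.
by rewrite cfunBE; exact: ltW (Ht u).
Qed.

Definition mean_param (F : G * G -> R) (cF : continuous F) : cfun R G :=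
  mk_cfun (@continuous_mean F cF).

Lemma continuous_swap (F : G * G -> R) :
  continuous F -> continuous (fun p : G * G => F (p.2, p.1)).
Proof.
by move=> cF; exact: (continuous_comp2 (@continuous_snd G G) (@continuous_fst G G) cF).
Qed.

(** Finitely many sections of [F] come within [e / 4] of all others, so one list [l] replaces the
    inner mean uniformly; the mean of the resulting finite average is an average of values of [K].
    The four quarters are [A1], [A2], [A3] and [H1]. *)
Lemma mean_fubini (F : G * G -> R) (cF : continuous F)
    (cF' : continuous (fun p : G * G => F (p.2, p.1))) :
  mean (mean_param cF) = mean (mean_param cF').
Proof.
apply/eqP; rewrite -subr_eq0 -normr_le0; apply/ler_addgt0Pr => e e0.
have e4 : 0 < e / 4 by rewrite divr_gt0.
pose V s := [set t | forall g, `|F (t, g) - F (s, g)| < e / 4].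
have nV s : nbhs s (V s) := compact_continuous_uniform cG s cF e4.
have [T T0 HT] := compact_finite_cover cG nV.
pose K := mean_param cF'.
have [l l0 Hl] :=
  mean_simultaneous cG (K :: [seq section_fun cF s | s <- T]) e4.
pose h := (size l)%:R^-1 *: \sum_(a <- l) section_fun cF' (1 * a)%g.
have hE s : h s = ravg l (section_fun cF s) 1%g.
  by rewrite /h cfunZE cfun_sumE.
have mh : mean h = ravg l K 1%g.
  by rewrite /h meanZ // mean_sum.
have H1 : `|mean h - mean K| <= e / 4 by rewrite mh Hl // inE eqxx.
have H2 : `|mean (mean_param cF) - mean h| <= e / 4 + (e / 4 + e / 4).
  rewrite -meanB //; apply: mean_bounded => // s.
  rewrite cfunBE hE; have [t tT Vt] := HT s.
  have Ht : section_fun cF t \in K :: [seq section_fun cF s | s <- T].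
    by rewrite inE map_f ?orbT.
  have A1 : `|mean (section_fun cF s) - mean (section_fun cF t)| <= e / 4.
    by rewrite -meanB //; apply: mean_bounded => // u; rewrite cfunBE; exact: ltW (Vt u).
  have A2 := Hl _ Ht 1%g.
  have A3 : `|ravg l (section_fun cF s) 1%g - ravg l (section_fun cF t) 1%g| <= e / 4.
    rewrite /ravg -mulrBr -sumrB.
    have := @ravg_dist R G l (section_fun cF s - section_fun cF t) 0 (e / 4) l0.
    move=> /(_ _ 1%g); rewrite subr0; apply => v.
    by rewrite subr0 cfunBE; exact: ltW (Vt v).
  move: A1 A2 A3; rewrite -/(mean_param cF s).
  have -> : mean_param cF s = mean (section_fun cF s) by [].
  rewrite !ler_norml; lra.
move: H1 H2; rewrite -/K !ler_norml; lra.
Qed.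

Lemma conv_continuous f k : continuous (fun p : G * G => f p.2 * k (p.2^-1 * p.1)%g).
Proof.
have c1 := @continuous_fst G G; have c2 := @continuous_snd G G.
apply: continuous_mulr.
  by apply: continuous_comp1; [exact: c2|exact: cfun_continuous].
apply: continuous_comp1; last exact: cfun_continuous.
by apply: mulg_continuous2 => //; apply: invg_continuous1.
Qed.

Definition conv f k : cfun R G := mean_param (@conv_continuous f k).
Definition dot f h : R := mean (cmul f h).

Lemma convE f k s : conv f k s = dot f (cinv (rtrans s k)).
Proof. by congr mean; apply: cfunP. Qed.

Lemma dotC f h : dot f h = dot h f.
Proof. by congr mean; apply: cfunP => u; rewrite !cmulE mulrC. Qed.

Lemma dotDl f h k : dot (f + h) k = dot f k + dot h k.
Proof. by rewrite /dot -meanD //; congr mean; apply: cfunP => u; rewrite cfunDE !cmulE mulrDl. Qed.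

Lemma dotZl a f k : dot (a *: f) k = a * dot f k.
Proof. by rewrite /dot -meanZ //; congr mean; apply: cfunP => u; rewrite cfunZE !cmulE mulrA. Qed.

Lemma dotDr f h k : dot k (f + h) = dot k f + dot k h.
Proof. by rewrite dotC dotDl !(dotC k). Qed.

Lemma dotZr a f k : dot k (a *: f) = a * dot k f.
Proof. by rewrite dotC dotZl dotC. Qed.

Lemma dotNl f h : dot (- f) h = - dot f h.
Proof. by rewrite -scaleN1r dotZl mulN1r. Qed.
Lemma dotNr f h : dot f (- h) = - dot f h.
Proof. by rewrite dotC dotNl dotC. Qed.
Lemma dotBl f h k : dot (f - h) k = dot f k - dot h k.
Proof. by rewrite dotDl dotNl. Qed.
Lemma dotBr f h k : dot k (f - h) = dot k f - dot k h.
Proof. by rewrite dotDr dotNr. Qed.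
Lemma dot0l f : dot 0 f = 0.
Proof. by rewrite -(scale0r f) dotZl mul0r. Qed.
Lemma dot_suml I (r : seq I) (P : pred I) (F : I -> cfun R G) h :
  dot (\sum_(i <- r | P i) F i) h = \sum_(i <- r | P i) dot (F i) h.
Proof. by apply: (big_morph (dot^~ h)) => [x y|]; rewrite ?dotDl ?dot0l. Qed.
Lemma dot_sumr I (r : seq I) (P : pred I) (F : I -> cfun R G) h :
  dot h (\sum_(i <- r | P i) F i) = \sum_(i <- r | P i) dot h (F i).
Proof. by rewrite dotC dot_suml; apply: eq_bigr => i _; rewrite dotC. Qed.

Lemma dot_ge0 f : 0 <= dot f f.
Proof. by apply: mean_ge0 => // u; rewrite cmulE -expr2 sqr_ge0. Qed.

Lemma dot_cauchy f h : dot f h ^+ 2 <= dot f f * dot h h.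
Proof.
have H t : 0 <= dot f f + t * dot f h *+ 2 + t ^+ 2 * dot h h.
  have := dot_ge0 (f + t *: h).
  by rewrite dotDl !dotDr !dotZl !dotZr (dotC h f) => /le_trans; apply; lra.
have [h0|h0] := eqVneq (dot h h) 0.
  have : dot f h = 0.
    apply/eqP; apply: contraT => fh.
    (* With [dot h h = 0] the quadratic is affine in [t]; this value makes it -1. *)
    have := H (- (dot f f + 1) / (dot f h *+ 2)).
    rewrite h0 mulr0 addr0 -mulrnAr divfK ?mulrn_eq0 ?negb_or //; lra.
  by move=> ->; rewrite h0 mulr0 expr0n.
have hp : 0 < dot h h by rewrite lt0r h0 dot_ge0.
have := H (- (dot f h) / dot h h).
have -> : dot f f + - dot f h / dot h h * dot f h *+ 2 +
  (- dot f h / dot h h) ^+ 2 * dot h h = dot f f - dot f h ^+ 2 / dot h h.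
  by field.
by rewrite subr_ge0 ler_pdivrMr.
Qed.

Lemma dot_ltrans a f h : dot (ltrans a f) (ltrans a h) = dot f h.
Proof. exact: (mean_ltrans cG a (cmul f h)). Qed.

Lemma dot_rtrans a f h : dot (rtrans a f) (rtrans a h) = dot f h.
Proof. exact: (mean_rtrans cG a (cmul f h)). Qed.

Lemma dot_cinv f h : dot (cinv f) (cinv h) = dot f h.
Proof. exact: (mean_inv cG (cmul f h)). Qed.

Lemma conv_sup f k s : conv f k s ^+ 2 <= dot f f * dot k k.
Proof. by rewrite convE (le_trans (dot_cauchy _ _)) // dot_cinv dot_rtrans. Qed.

Lemma conv_bound f k : dot (conv f k) (conv f k) <= dot f f * dot k k.
Proof.
rewrite -[X in _ <= X](mean_cst cG); apply: mean_le => // u.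
by rewrite ccstE cmulE -expr2 conv_sup.
Qed.

Lemma mean_abs_dot f : mean (cabs f) ^+ 2 <= dot f f.
Proof.
have -> : mean (cabs f) = dot (cabs f) (ccst 1).
  by congr mean; apply: cfunP => u; rewrite cmulE mulr1.
rewrite (le_trans (dot_cauchy _ _)) //.
have -> : dot (ccst 1) (ccst 1) = 1.
  by rewrite -[RHS](mean_cst cG 1); congr mean; apply: cfunP => u; rewrite cmulE mulr1.
rewrite mulr1 /dot; apply: mean_le => // u.
by rewrite !cmulE cabsE -expr2 real_normK ?num_real // expr2.
Qed.

Lemma conv1E f k : conv f k 1%g = dot f (cinv k).
Proof. by rewrite convE; congr dot; apply: cfunP => u; rewrite !cinvE rtransE mulg1. Qed.

Lemma convDl f h k : conv (f + h) k = conv f k + conv h k.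
Proof. by apply: cfunP => u; rewrite cfunDE !convE dotDl. Qed.
Lemma convZl a f k : conv (a *: f) k = a *: conv f k.
Proof. by apply: cfunP => u; rewrite cfunZE !convE dotZl. Qed.
Lemma convDr f h k : conv k (f + h) = conv k f + conv k h.
Proof.
apply: cfunP => u; rewrite cfunDE !convE -dotDr; congr dot.
by apply: cfunP.
Qed.
Lemma convZr a f k : conv k (a *: f) = a *: conv k f.
Proof.
apply: cfunP => u; rewrite cfunZE !convE -dotZr; congr dot.
by apply: cfunP.
Qed.
Lemma convNl f h : conv (- f) h = - conv f h.
Proof. by rewrite -scaleN1r convZl scaleN1r. Qed.
Lemma convNr f h : conv f (- h) = - conv f h.
Proof. by rewrite -scaleN1r convZr scaleN1r. Qed.
Lemma convBl f h k : conv (f - h) k = conv f k - conv h k.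
Proof. by rewrite convDl convNl. Qed.
Lemma convBr f h k : conv k (f - h) = conv k f - conv k h.
Proof. by rewrite convDr convNr. Qed.

(** Hence the functions fixed by [** e] form a space invariant under left translation. *)
Lemma ltrans_conv a f k : ltrans a (conv f k) = conv (ltrans a f) k.
Proof.
apply: cfunP => u; rewrite ltransE !convE -(dot_ltrans a f).
congr dot; apply: cfunP => t.
by rewrite ltransE !cinvE !rtransE invgM -!mulgA mulKg.
Qed.

Lemma cinv_conv f k : cinv (conv f k) = conv (cinv k) (cinv f).
Proof.
apply: cfunP => u; rewrite cinvE !convE dotC.
rewrite -[RHS](dot_ltrans u); congr dot; apply: cfunP => t.
- by rewrite ltransE !cinvE rtransE invgM.
- by rewrite ltransE !cinvE rtransE cinvE !invgM !invgK mulKg.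
Qed.

(** Fubini exchanges the two means; left invariance then substitutes [t^-1 * r] for the inner
    variable. *)
Lemma conv_assoc f h k : conv (conv f h) k = conv f (conv h k).
Proof.
apply: cfunP => s.
have cF : continuous (fun p : G * G =>
    f p.2 * h (p.2^-1 * p.1)%g * k (p.1^-1 * s)%g).
  apply: continuous_mulr; first exact: conv_continuous.
  apply: continuous_comp1; last exact: cfun_continuous.
  apply: mulg_continuous2; last exact: cst_continuous.
  by apply: invg_continuous1; exact: continuous_fst.
have := mean_fubini cF (continuous_swap cF).
have -> : mean (mean_param cF) = conv (conv f h) k s.
  congr mean; apply: cfunP => t.
  transitivity (k (t^-1 * s)%g * conv f h t); last by rewrite mulrC.
  rewrite -[RHS](meanZ cG); congr mean; apply: cfunP => r.
  by rewrite cfunZE mulrC.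
move=> ->; congr mean; apply: cfunP => t.
transitivity (f t * conv h k (t^-1 * s)%g); last by [].
rewrite -[RHS](meanZ cG) -[RHS](mean_ltrans cG t^-1%g).
congr mean; apply: cfunP => r; rewrite ltransE cfunZE.
transitivity (f t * h (t^-1 * r)%g * k (r^-1 * s)%g); first by [].
transitivity (f t * (h (t^-1 * r)%g * k ((t^-1 * r)^-1 * (t^-1 * s))%g)); last by [].
by rewrite invgM invgK -!mulgA mulVKg mulrA.
Qed.

(** The adjoint of [** k] is [** cinv k], so symmetric kernels give self-adjoint operators; both
    sides are a triple convolution at [1]. *)
Lemma dot_convl f h k : dot (conv f k) h = dot f (conv h (cinv k)).
Proof. by rewrite -(cinvK h) -conv1E conv_assoc conv1E cinv_conv !cinvK. Qed.

End Convolution.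

(** * Spectral theory of convolution operators *)

Section Idempotents.
Context {R : realType} {G : topGroupType} (cG : compact [set: G]).
Implicit Types (f h k e psi w : cfun R G) (q : nat -> cfun R G).
Local Notation "f ** h" := (conv cG f h) (at level 40, left associativity).
Local Notation norm2 f := (dot f f).

Definition ucvg q e := forall d : R, 0 < d ->
  exists N, forall n, (N <= n)%N -> forall u, `|q n u - e u| <= d.

Lemma cfun_complete q :
  (forall d : R, 0 < d -> exists N, forall n m, (N <= n)%N -> (N <= m)%N ->
     forall u, `|q n u - q m u| <= d) ->
  exists e, ucvg q e.
Proof.
move=> Hq.
have cu u : cvgn (fun n => q n u : R).
  apply/cauchy_cvgP/cauchyP => d d0; have d2 : 0 < d / 2 by rewrite divr_gt0.
  have [N HN] := Hq _ d2; exists (q N u); exists N => // n /= Nn.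
  rewrite /ball /= (@le_lt_trans _ _ (d / 2)) //; last by rewrite gtr_pMr // invf_lt1 // ltr1n.
  exact: HN.
pose e u := limn (fun n => q n u : R).
have ue (d : R) : 0 < d -> exists N, forall n, (N <= n)%N -> forall u, `|q n u - e u| <= d.
  move=> d0; have [N HN] := Hq _ d0; exists N => n Nn u.
  apply/ler_addgt0Pr => c c0.
  have /cvgrPdist_lt/(_ _ c0)[M _ HM] := cu u.
  have h1 := HM (maxn N M) (leq_maxr _ _).
  have h2 := HN n (maxn N M) Nn (leq_maxl _ _) u.
  rewrite (le_trans (ler_distD (q (maxn N M) u) _ _)) // lerD //.
  by rewrite distrC ltW.
have ce : continuous e.
  move=> u; apply/cvgrPdist_le => d d0; have d3 : 0 < d / 3 by rewrite divr_gt0.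
  have [N HN] := ue _ d3.
  have /cvgrPdist_lt/(_ _ d3) := @cfun_continuous _ _ (q N) u.
  apply: filterS => v uv; have := HN N (leqnn _) u; have := HN N (leqnn _) v.
  by move: uv => /ltW; rewrite !ler_norml; lra.
by exists (mk_cfun ce).
Qed.

Lemma ucvg_unique q e e' : ucvg q e -> ucvg q e' -> e = e'.
Proof.
move=> H H'; apply: cfunP => u; apply/eqP; rewrite -subr_eq0 -normr_le0.
apply/ler_addgt0Pr => d d0; have d2 : 0 < d / 2 by rewrite divr_gt0.
have [N HN] := H _ d2; have [M HM] := H' _ d2.
have := HN (maxn N M) (leq_maxl _ _) u; have := HM (maxn N M) (leq_maxr _ _) u.
by rewrite !ler_norml; lra.
Qed.

Lemma ucvg_ext q q' e : (forall n, q n = q' n) -> ucvg q e -> ucvg q' e.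
Proof. by move=> E H d /H[N HN]; exists N => n Nn u; rewrite -E; exact: HN. Qed.

Lemma ucvg_cst e : ucvg (fun=> e) e.
Proof. by move=> d d0; exists 0%N => n _ u; rewrite subrr normr0 ltW. Qed.

Lemma ucvg_shift q e (k : nat) : ucvg q e -> ucvg (fun n => q (n + k)%N) e.
Proof.
by move=> H d /H[N HN]; exists N => n Nn u; apply: HN; exact: leq_trans Nn (leq_addr _ _).
Qed.

Lemma ucvg_cinv q e : ucvg q e -> ucvg (fun n => cinv (q n)) (cinv e).
Proof. by move=> H d /H[N HN]; exists N => n Nn u; rewrite !cinvE; exact: HN. Qed.

(** Young's inequality for the sup norm and the L^1 norm; it carries uniform limits through
    convolution. *)
Lemma conv_norm_le f k c u : (forall v, `|f v| <= c) -> `|(f ** k) u| <= c * mean (cabs k).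
Proof.
move=> fc; rewrite convE (le_trans (mean_abs cG _)) //.
have c0 : 0 <= c by apply: le_trans (fc 1%g).
rewrite -(mean_inv cG (cabs k)) -[mean (cinv (cabs k))](mean_ltrans cG u^-1%g) -meanZ //.
apply: mean_le => // v; rewrite cabsE cmulE normrM cfunZE ltransE !cinvE cabsE.
by rewrite rtransE invgM invgK ler_wpM2r.
Qed.

Lemma ucvg_convl q e k : ucvg q e -> ucvg (fun n => q n ** k) (e ** k).
Proof.
move=> H d d0; pose c := mean (cabs k) + 1.
have c0 : 0 < c by rewrite ltr_wpDl //; apply: mean_ge0 => // v; rewrite cabsE.
have [N HN] := H _ (divr_gt0 d0 c0); exists N => n Nn u.
have -> : (q n ** k) u - (e ** k) u = ((q n - e) ** k) u by rewrite convBl.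
rewrite (le_trans (@conv_norm_le (q n - e) k _ u (HN n Nn))) //.
rewrite mulrAC ler_pdivrMr // ler_wpM2l ?ltW // /c; lra.
Qed.

Lemma ucvg_convr q e k : ucvg q e -> ucvg (fun n => k ** q n) (k ** e).
Proof.
move=> /ucvg_cinv/(@ucvg_convl _ _ (cinv k))/ucvg_cinv.
by rewrite cinv_conv !cinvK; apply: ucvg_ext => n; rewrite cinv_conv !cinvK.
Qed.

Section TopIdempotent.
Context (psi : cfun R G) (psiK : cinv psi = psi).

(** The power n+1 of [psi]: convolution need not have a unit in [cfun], so counting starts at the
    first power. *)
Fixpoint cpow n := if n is n'.+1 then cpow n' ** psi else psi.

Lemma cpow_val_eq n m u : n = m -> cpow n u = cpow m u.
Proof. by move->. Qed.

Lemma cpow_conv n m : cpow n ** cpow m = cpow (n + m).+1.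
Proof.
by elim: m => [|m IH] /=; rewrite ?addn0 // addnS -conv_assoc IH.
Qed.

Lemma cpow_cinv n : cinv (cpow n) = cpow n.
Proof.
elim: n => //= n IH; rewrite cinv_conv IH psiK.
by rewrite -[psi]/(cpow 0) !cpow_conv addn0.
Qed.

Lemma dot_cpow n m : dot (cpow n) (cpow m) = cpow (n + m).+1 1%g.
Proof. by rewrite -cpow_conv conv1E cpow_cinv. Qed.

(** [norm2] is the squared norm; the two assumptions say that [** psi] has operator norm 1,
    approached but perhaps not reached. *)
Context (contr : forall f, norm2 (f ** psi) <= norm2 f).
Context (attained : forall eta : R, 0 < eta -> eta < 1 ->
  exists2 f, 0 < norm2 f & eta * norm2 f <= norm2 (f ** psi)).

Lemma norm2_cpow_decr n : norm2 (cpow n.+1) <= norm2 (cpow n).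
Proof. exact: contr. Qed.

Lemma bernoulli (x : R) n : 0 <= x -> x <= 1 -> 1 - n%:R * x <= (1 - x) ^+ n.
Proof.
move=> x0 x1; elim: n => [|n IH]; first by rewrite mul0r subr0 expr0.
rewrite exprS; apply: (@le_trans _ _ ((1 - x) * (1 - n%:R * x))).
  rewrite -natr1; have : 0 <= n%:R * x * x by rewrite !mulr_ge0. 
  by move=> ?; lra.
by rewrite ler_wpM2l // subr_ge0.
Qed.

(* The norms of the iterates [f ** cpow n] are logarithmically convex in [n]. *)
Lemma norm2_conv_cpow_ge (eta : R) f n : 0 < eta -> 0 < norm2 f ->
  eta * norm2 f <= norm2 (f ** psi) ->
  eta ^+ n.+1 * norm2 f <= norm2 (f ** cpow n).
Proof.
move=> eta0 f0 Hf.
suff : 0 < norm2 (f ** cpow n) /\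
    eta ^+ n.+1 * norm2 f <= norm2 (f ** cpow n) /\
    eta * norm2 (f ** cpow n) <= norm2 (f ** cpow n.+1) by case=> _ [].
have step h : 0 < norm2 h -> eta * norm2 h <= norm2 (h ** psi) ->
    eta * norm2 (h ** psi) <= norm2 (h ** psi ** psi).
  move=> h0 Hh; have h1 : 0 < norm2 (h ** psi).
    by apply: lt_le_trans Hh; rewrite mulr_gt0.
  have := dot_cauchy cG h (h ** psi ** psi).
  have -> : dot h (h ** psi ** psi) = norm2 (h ** psi) by rewrite dot_convl psiK.
  move=> H; rewrite -(ler_pM2l h0); apply: le_trans H.
  by rewrite mulrCA mulrA expr2 ler_pM2r.
elim: n => [|n [IH1 [IH2 IH3]]] /=.
  by rewrite expr1 -conv_assoc; split; [|split=> //; exact: step];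
    apply: lt_le_trans Hf; rewrite mulr_gt0.
rewrite /= -conv_assoc in IH3; rewrite -!conv_assoc; split; [|split].
- exact: lt_le_trans (mulr_gt0 eta0 IH1) IH3.
- by rewrite exprS -mulrA (le_trans _ IH3) // ler_wpM2l // ltW.
- exact: step.
Qed.

(** A function nearly attaining the operator norm of [psi] does so for every power, and [conv_bound]
    transfers this to the kernel. It keeps the limit of the powers from vanishing. *)
Lemma norm2_cpow_ge1 n : 1 <= norm2 (cpow n).
Proof.
apply/ler_addgt0Pr => d d0.
(* The first bound keeps [1 - x] positive, the second limits the Bernoulli loss to [d]. *)
pose x := Num.min (2^-1) (d / n.+1%:R).
have x0 : 0 < x by rewrite lt_min invr_gt0 ltr0n divr_gt0.
have x1 : x < 1 by rewrite gt_min invf_lt1 ?ltr1n.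
have xd : n.+1%:R * x <= d by rewrite mulrC -ler_pdivlMr ?ltr0n // ge_min lexx orbT.
have [||f f0 Hf] := attained (eta := 1 - x); first by rewrite subr_gt0.
  by rewrite ltrBlDr ltrDl.
have H := norm2_conv_cpow_ge n (_ : 0 < 1 - x) f0 Hf.
have {}H := H ltac:(by rewrite subr_gt0).
have := le_trans H (conv_bound cG f (cpow n)).
rewrite mulrC ler_pM2l // => {}H.
rewrite -lerBlDr (le_trans _ H) // (le_trans _ (bernoulli _ (ltW x0) (ltW x1))) //.
by rewrite lerD2l lerN2.
Qed.

(* [dot (cpow n) (cpow m)] depends on [n + m] only, hence the bounded monotone
   sequence of the norms makes the odd-indexed [cpow] (even powers of [psi])
   Cauchy for [dot]; one more convolution makes them uniformly Cauchy. *)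
Lemma exists_top_idempotent : exists e, [/\ cinv e = e, e ** e = e,
  psi ** e = e ** psi, psi ** (psi ** e) = e & 1 <= norm2 e].
Proof.
(* [q n] is [psi] to the power 2n+4: the even power [cpow n.*2.+1] times [cpow 1], the factor
   reserved for uniformity. Powers are even because an eigenvalue -1 of [psi] would make the full
   sequence oscillate. *)
pose a n := norm2 (cpow n); pose q n := cpow (n.*2.+1 + 2).
have decr n m : (n <= m)%N -> a m <= a n.
  elim: m => [|m IH]; first by rewrite leqn0 => /eqP->.
  rewrite leq_eqVlt => /predU1P[->//|/IH]; apply: le_trans; exact: norm2_cpow_decr.
have [L [Lge1 HL]] : exists L, (forall n, L <= a n) /\
    forall d : R, 0 < d -> exists N, a N < L + d.
  have HS : has_inf (range a).
    by split; [exists (a 0%N), 0%N | exists 1 => _ [n _ <-]; exact: norm2_cpow_ge1].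
  exists (inf (range a)); split => [n|d d0]; first by apply: ge_inf; [case: HS|exists n].
  by have [_ [N _ <-] HN] := inf_adherent d0 HS; exists N.
have cauchy2 d : 0 < d -> exists N, forall n m, (N <= n)%N -> (N <= m)%N ->
    norm2 (cpow n.*2.+1 - cpow m.*2.+1) <= d.
  move=> d0; have d2 : 0 < d / 2 by rewrite divr_gt0.
  have [N HN] := HL _ d2; exists N => n m Nn Nm.
  have E (k : nat) : (N <= k)%N -> L <= a k <= L + d / 2.
    by move=> Nk; rewrite Lge1 (le_trans (decr _ _ Nk)) // ltW.
  have -> : norm2 (cpow n.*2.+1 - cpow m.*2.+1) =
      a n.*2.+1 + a m.*2.+1 - a (n + m).+1 *+ 2.
    rewrite dotBl // !dotBr // [dot (cpow m.*2.+1) (cpow n.*2.+1)]dotC.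
    have -> : dot (cpow n.*2.+1) (cpow m.*2.+1) = a (n + m).+1.
      by rewrite /a !dot_cpow; apply: cpow_val_eq; lia.
    by rewrite /a; ring.
  have := E n.*2.+1; have := E m.*2.+1; have := E (n + m).+1.
  move=> /(_ ltac:(lia)) /andP[? ?] /(_ ltac:(lia)) /andP[? ?] /(_ ltac:(lia)) /andP[? ?].
  lra.
have [e qe] : exists e, ucvg q e.
  apply: cfun_complete => d d0; pose c := norm2 (cpow 1).
  have c0 : 0 < c by apply: lt_le_trans (norm2_cpow_ge1 1).
  have [N HN] := cauchy2 (d ^+ 2 / c) (divr_gt0 (exprn_gt0 2 d0) c0).
  exists N => n m Nn Nm u.
  rewrite -(@ler_pXn2r _ 2) ?nnegrE ?(ltW d0) // real_normK ?num_real //.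
  have qq (k : nat) : q k = cpow k.*2.+1 ** cpow 1 by rewrite cpow_conv; congr cpow; lia.
  have -> : q n u - q m u = ((cpow n.*2.+1 - cpow m.*2.+1) ** cpow 1) u.
    by rewrite convBl cfunBE !qq.
  apply: le_trans (conv_sup cG _ _ _) _.
  by rewrite -/c -ler_pdivlMr //; exact: HN.
(* A product of two terms of [q] is a later term of [q], so multiplying by [q m] only shifts the
   sequence. *)
have qn m : q m ** e = e.
  apply: (@ucvg_unique (fun n => q m ** q n)); first exact: ucvg_convr.
  apply: ucvg_ext (ucvg_shift (m + 2) qe) => n; rewrite /q cpow_conv; congr cpow; lia.
exists e; split.
- apply: ucvg_unique (ucvg_cinv qe) _.
  by apply: ucvg_ext qe => n; rewrite cpow_cinv.
- apply: ucvg_unique (ucvg_convl e qe) _.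
  by apply: ucvg_ext (ucvg_cst e) => n.
- apply: ucvg_unique (ucvg_convr psi qe) _.
  apply: ucvg_ext (ucvg_convl psi qe) => n.
  by rewrite -[psi]/(cpow 0) !cpow_conv addn0.
- rewrite -conv_assoc.
  apply: ucvg_unique (ucvg_convr (psi ** psi) qe) _.
  apply: ucvg_ext (ucvg_shift 1 qe) => n.
  by rewrite -[psi ** psi]/(cpow 1) cpow_conv /q; congr cpow; lia.
- have ee : cinv e = e.
    apply: ucvg_unique (ucvg_cinv qe) _.
    by apply: ucvg_ext qe => n; rewrite cpow_cinv.
  have e2 : e ** e = e.
    apply: ucvg_unique (ucvg_convl e qe) _.
    by apply: ucvg_ext (ucvg_cst e) => n.
  have -> : norm2 e = e 1%g by rewrite -{2}ee -conv1E e2.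
  apply/ler_addgt0Pr => d d0; have [N HN] := qe _ d0.
  have := HN N (leqnn _) 1%g.
  have -> : q N 1%g = a N.+1 by rewrite /a dot_cpow; apply: cpow_val_eq; lia.
  by have := norm2_cpow_ge1 N.+1; rewrite -/(a _) ler_norml => ? /andP[? ?]; lra.
Qed.

End TopIdempotent.

Definition l2_small (d : R) w := forall f, norm2 (f ** w) <= d * norm2 f.

(** Let [L] be the squared operator norm. Divided by the square root of [L], [psi] satisfies the
    assumptions of [exists_top_idempotent]. Then [psi ** e] is an orthogonal projection of [psi]
    with squared norm [L * norm2 e], and [L > d] with [norm2 e >= 1] gives the drop. *)
Lemma exists_idempotent psi (d : R) : cinv psi = psi -> 0 < d -> ~ l2_small d psi ->
  exists e, [/\ cinv e = e, e ** e = e, psi ** e = e ** psi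
    & norm2 (psi - psi ** e) <= norm2 psi - d].
Proof.
move=> psiK d0 /existsNP[f0 /negP]; rewrite -ltNge => Hf0.
pose S := [set norm2 (f ** psi) | f in [set f | norm2 f <= 1]].
have f0p : 0 < norm2 f0.
  rewrite lt0r dot_ge0 // andbT; apply: contraTneq Hf0 => f00.
  have := conv_bound cG f0 psi; rewrite f00 mul0r mulr0 -leNgt; exact.
have scale f : 0 < norm2 f -> norm2 ((Num.sqrt (norm2 f))^-1 *: f) = 1.
  move=> fp; rewrite dotZl // dotZr // mulrA -invfM -expr2 sqr_sqrtr ?ltW //.
  by rewrite mulVf ?gt_eqF.
have scaleS f : 0 < norm2 f -> S (norm2 (f ** psi) / norm2 f).
  move=> fp; exists ((Num.sqrt (norm2 f))^-1 *: f); first by rewrite /= scale.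
  rewrite convZl dotZl // dotZr // mulrA -invfM -expr2 sqr_sqrtr ?ltW //.
  by rewrite mulrC.
have HS : has_sup S.
  split; first by exists (norm2 (f0 ** psi) / norm2 f0); exact: scaleS.
  exists (norm2 psi) => _ [f /= f1 <-]; rewrite (le_trans (conv_bound cG _ _)) //.
  by rewrite ler_piMl ?dot_ge0.
pose L := sup S.
have dL : d < L.
  apply: lt_le_trans (ub_le_sup (proj2 HS) (scaleS _ f0p)).
  by rewrite ltr_pdivlMr.
have Lp : 0 < L := lt_trans d0 dL.
pose phi := (Num.sqrt L)^-1 *: psi.
have sL : Num.sqrt L ^+ 2 = L by rewrite sqr_sqrtr ?ltW.
have sL0 : Num.sqrt L != 0 by rewrite sqrtr_eq0 -ltNge.
have phiK : cinv phi = phi.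
  by apply: cfunP => u; rewrite cinvE !cfunZE -[in LHS]psiK cinvE invgK.
have nphi f : norm2 (f ** phi) = norm2 (f ** psi) / L.
  by rewrite convZr dotZl // dotZr // mulrA -invfM -expr2 sL mulrC.
have contr f : norm2 (f ** phi) <= norm2 f.
  rewrite nphi ler_pdivrMr //.
  have [f00|fn0] := eqVneq (norm2 f) 0.
    by have := conv_bound cG f psi; rewrite f00 !mul0r.
  have fp : 0 < norm2 f by rewrite lt0r fn0 dot_ge0.
  by have := ub_le_sup (proj2 HS) (scaleS _ fp); rewrite ler_pdivrMr // mulrC.
have attained (eta : R) : 0 < eta -> eta < 1 ->
    exists2 f, 0 < norm2 f & eta * norm2 f <= norm2 (f ** phi).
  move=> eta0 eta1; have [|_ [f /= f1 <-] Hf] := @sup_adherent _ S (L * (1 - eta)) _ HS.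
    by rewrite mulr_gt0 // subr_gt0.
  have {}Hf : L * eta < norm2 (f ** psi) by move: Hf; rewrite -/L; lra.
  exists f.
    rewrite lt0r dot_ge0 // andbT; apply: contraTneq Hf => f00.
    rewrite -leNgt (le_trans (conv_bound cG _ _)) // f00 mul0r mulr_ge0 // ltW //.
  rewrite nphi ler_pdivlMr // mulrC mulrA (le_trans _ (ltW Hf)) //.
  by rewrite ler_piMr // mulr_ge0 ?ltW.
have [e [e1 e2 e3 e4 e5]] := exists_top_idempotent phiK contr attained.
have psiE : psi = Num.sqrt L *: phi by rewrite scalerA mulfV // scale1r.
clearbody phi.
have pe : psi ** e = e ** psi by rewrite psiE convZl convZr e3.
have ppe : psi ** (psi ** e) = L *: e.
  by rewrite psiE !convZl convZr e4 scalerA -expr2 sL.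
exists e; split => //.
have E1 : dot psi (psi ** e) = L * norm2 e.
  have -> : psi ** e = cinv (psi ** e) by rewrite cinv_conv psiK e1 pe.
  by rewrite -conv1E ppe cfunZE -{3}e1 -conv1E e2.
have E2 : norm2 (psi ** e) = L * norm2 e.
  by rewrite dot_convl e1 conv_assoc e2 E1.
rewrite dotBl // !dotBr // (dotC (psi ** e) psi) E1 E2.
have : d * 1 <= L * norm2 e by rewrite ler_pM // ltW.
lra.
Qed.

Definition idempotent_sum w := exists s : seq (cfun R G * cfun R G),
  (forall p, p \in s -> p.2 ** p.2 = p.2) /\
  w = \sum_(p <- s) p.1 ** p.2.

(* Each [psi ** e] split off lowers [norm2 psi] by at least [d]. *)
Lemma idempotent_approximation psi (d : R) : cinv psi = psi -> 0 < d ->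
  exists2 w, idempotent_sum w & l2_small d (psi - w).
Proof.
move=> psiK d0.
suff H n : forall psi, cinv psi = psi -> norm2 psi < n%:R * d ->
    exists2 w, idempotent_sum w & l2_small d (psi - w).
  apply: (H (Num.truncn (norm2 psi / d)).+1) => //.
  by rewrite -ltr_pdivrMr // truncnS_gt.
elim: n => [|n IH] {psiK}psi psiK Hn.
  by have := dot_ge0 cG psi; rewrite leNgt -(mul0r d) Hn.
have [sm|/(exists_idempotent psiK d0)[e [e1 e2 e3 e4]]] := pselect (l2_small d psi).
  exists 0; last by rewrite subr0.
  by exists [::]; rewrite big_nil.
have [||w [s [Hs ws]] Hw] := IH (psi - psi ** e).
- have -> : cinv (psi - psi ** e) = cinv psi - cinv (psi ** e) by apply: cfunP.
  by rewrite cinv_conv psiK e1 e3.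
- by rewrite (le_lt_trans e4) // ltrBlDr; move: Hn; rewrite -natr1 mulrDl mul1r.
exists (psi ** e + w); last by rewrite opprD addrA.
exists ((psi, e) :: s); split; last by rewrite big_cons ws.
by move=> p; rewrite inE => /predU1P[->|/Hs].
Qed.

End Idempotents.

(** * Finite dimension of the space fixed by a convolution *)

Section FiniteRank.
Context {R : realType} {G : topGroupType} (cG : compact [set: G]).
Implicit Types (f h k : cfun R G).
Local Notation "f ** h" := (conv cG f h) (at level 40, left associativity).
Local Notation norm2 f := (dot f f).

Definition orthonormal_family n (w : 'I_n -> cfun R G) :=
  forall i j, dot (w i) (w j) = (i == j)%:R.

Lemma dot_orthonormal_sum n (w : 'I_n -> cfun R G) (c : 'I_n -> R) j :
  orthonormal_family w -> dot (\sum_i c i *: w i) (w j) = c j.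
Proof.
move=> ow; rewrite dot_suml // (bigD1 j) //= big1 ?addr0 => [|i ij].
  by rewrite dotZl // ow eqxx mulr1.
by rewrite dotZl // ow (negbTE ij) mulr0.
Qed.

Lemma bessel n (w : 'I_n -> cfun R G) k : orthonormal_family w ->
  \sum_i dot k (w i) ^+ 2 <= norm2 k.
Proof.
move=> ow; pose p := \sum_i dot k (w i) *: w i.
have pk : dot p k = \sum_i dot k (w i) ^+ 2.
  by rewrite dot_suml //; apply: eq_bigr => i _; rewrite dotZl // dotC expr2.
have pp : dot p p = \sum_i dot k (w i) ^+ 2.
  rewrite {2}/p dot_sumr //; apply: eq_bigr => i _.
  by rewrite dotZr // dot_orthonormal_sum // expr2.
have := dot_ge0 cG (k - p); rewrite dotBl // !dotBr // (dotC k p) pk pp; lra.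
Qed.

Lemma conv_suml I (r : seq I) (P : pred I) (F : I -> cfun R G) h :
  (\sum_(i <- r | P i) F i) ** h = \sum_(i <- r | P i) F i ** h.
Proof.
apply: (big_morph (fun x => x ** h)) => [x y|]; first exact: convDl.
by rewrite -[X in X ** h](scale0r h) convZl scale0r.
Qed.

Context (e : cfun R G).

Lemma range_sup f u : f ** e = f -> f u ^+ 2 <= norm2 f * norm2 e.
Proof. by move=> {1}<-; exact: conv_sup. Qed.

(* [w i u] is the inner product of [w i] with a translate of the reflection of
   [e], which has the norm of [e]; integrate Bessel's inequality over [u]. *)
Lemma range_orthonormal_bound n (w : 'I_n -> cfun R G) :
  orthonormal_family w -> (forall i, w i ** e = w i) -> n%:R <= norm2 e.
Proof.
move=> ow we.
have -> : n%:R = mean (\sum_i cmul (w i) (w i)).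
  rewrite mean_sum // (eq_bigr (fun=> 1)); last first.
    by move=> i _; rewrite -/(dot _ _) ow eqxx.
  by rewrite sumr_const card_ord.
rewrite -[leRHS](mean_cst cG); apply: mean_le => // u.
rewrite cfun_sumE ccstE -(dot_rtrans cG u) -(dot_cinv cG).
apply: le_trans (bessel _ ow); apply: ler_sum => i _.
by rewrite cmulE -expr2 -{1}(we i) convE dotC.
Qed.

Definition extend_family n (w : 'I_n -> cfun R G) f (i : 'I_n.+1) :=
  if unlift ord0 i is Some j then w j else f.

(** Orthonormal families are bounded in size, so a maximal one exists; the normalised remainder of a
    fixed function outside its span would extend it. *)
Lemma exists_orthonormal_basis : exists n (w : 'I_n -> cfun R G),
  [/\ orthonormal_family w, forall i, w i ** e = w i
    & forall f, f ** e = f -> f = \sum_i dot f (w i) *: w i].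
Proof.
pose P n := `[< exists w : 'I_n -> cfun R G,
  orthonormal_family w /\ forall i, w i ** e = w i >].
have P0 : exists n, P n.
  by exists 0%N; apply/asboolP; exists (fun=> 0); split => -[].
have Pb n : P n -> (n <= Num.truncn (norm2 e))%N.
  move=> /asboolP[w [ow we]]; rewrite truncn_ge_nat ?dot_ge0 //.
  exact: range_orthonormal_bound we.
have [n /asboolP[w [ow we]] nmax] := ex_maxnP P0 Pb.
exists n, w; split => // f fe.
pose p := \sum_i dot f (w i) *: w i; pose g := f - p.
apply/eqP; rewrite -/p -subr_eq0 -/g; apply: contraT => g0.
have pe : p ** e = p.
  by rewrite conv_suml; apply: eq_bigr => i _; rewrite convZl we.
have ge : g ** e = g by rewrite convBl fe pe.
have gw i : dot g (w i) = 0.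
  by rewrite dotBl // dot_orthonormal_sum // subrr.
have gp : 0 < norm2 g.
  rewrite lt0r dot_ge0 // andbT; apply: contraNneq g0 => g0; apply/eqP.
  apply: cfunP => u; apply/eqP; rewrite -sqrf_eq0 eq_le sqr_ge0 andbT.
  by rewrite (le_trans (range_sup u ge)) // g0 mul0r.
pose g1 := (Num.sqrt (norm2 g))^-1 *: g.
have g1e : g1 ** e = g1 by rewrite convZl ge.
have g1n : norm2 g1 = 1.
  rewrite dotZl // dotZr // mulrA -invfM -expr2 sqr_sqrtr ?ltW //.
  by rewrite mulVf // gt_eqF.
have g1w i : dot g1 (w i) = 0 by rewrite dotZl // gw mulr0.
have := nmax n.+1; rewrite ltnn => -> //; apply/asboolP.
exists (extend_family w g1); rewrite /extend_family; split => [i j|i].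
  case: unliftP => [i'|] ->; case: unliftP => [j'|] ->.
  - by rewrite ow (inj_eq lift_inj).
  - by rewrite dotC g1w eq_sym (negbTE (neq_lift _ _)).
  - by rewrite g1w (negbTE (neq_lift _ _)).
  - by rewrite g1n eqxx.
by case: unlift.
Qed.
End FiniteRank.

(** * The orthogonal representation on the fixed space *)

Section RangeRepresentation.
Context {R : realType} {G : topGroupType} (cG : compact [set: G]).
Local Notation "f ** h" := (conv cG f h) (at level 40, left associativity).

Lemma continuous_mx (T : topologicalType) (K : topologicalType) m n
    (M : T -> 'M[K]_(m, n)) :
  (forall i j, continuous (fun t => M t i j)) -> continuous M.
Proof.
move=> cM t A [P nP PA].
suff : \forall u \near t, forall i j, P i j (M u i j).
  by apply: filterS => u; exact: PA.
apply: filter_forall => i; apply: filter_forall => j.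
exact: cM (nP i j).
Qed.

(* [real_complex] with codomain [Cplx R], on which the topology is found. *)
Definition cplx (x : R) : Cplx R := real_complex R x.

Lemma cplx0 : cplx 0 = 0. Proof. exact: (rmorph0 (real_complex R)). Qed.
Lemma cplx1 : cplx 1 = 1. Proof. exact: (rmorph1 (real_complex R)). Qed.
Lemma cplxD x y : cplx (x + y) = cplx x + cplx y.
Proof. exact: (rmorphD (real_complex R)). Qed.
Lemma cplxB x y : cplx (x - y) = cplx x - cplx y.
Proof. exact: (rmorphB (real_complex R)). Qed.
Lemma cplxM x y : cplx (x * y) = cplx x * cplx y.
Proof. exact: (rmorphM (real_complex R)). Qed.
Lemma cplx_sum I (r : seq I) (P : pred I) (F : I -> R) :
  cplx (\sum_(i <- r | P i) F i) = \sum_(i <- r | P i) cplx (F i).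
Proof. exact: (rmorph_sum (real_complex R)). Qed.
Lemma conj_cplx x : (cplx x)^* = cplx x.
Proof. by rewrite /cplx /Num.conj /= oppr0. Qed.
Lemma norm_cplx x : `|cplx x| = cplx `|x|.
Proof.
by rewrite [LHS](normc_def (real_complex R x)) /= expr0n addr0 sqrtr_sqr.
Qed.

Lemma cplx_continuous : continuous cplx.
Proof.
move=> x; apply/cvgrPdist_lt => e e0.
(* Positivity in [Cplx R] forces [e] to be real. *)
have eE : e = cplx (complex.Re e).
  by move: e0; rewrite ltcE /= => /andP[/eqP h _]; case: e h => a b /= ->.
rewrite eE in e0 *; have {}e0 : 0 < complex.Re e by move: e0; rewrite ltcR.
have /cvgrPdist_lt/(_ _ e0) := @continuous_id R x; apply: filterS => y /=.
by rewrite -cplxB norm_cplx ltcR.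
Qed.

Section Construction.
Local Open Scope sesquilinear_scope.
Context (e : cfun R G) (n : nat) (w : 'I_n -> cfun R G).
Context (ow : orthonormal_family w) (we : forall i, w i ** e = w i).
Context (wE : forall f, f ** e = f -> f = \sum_i dot f (w i) *: w i).

(** The left regular representation in the basis [w], as real orthogonal matrices. *)
Definition range_coef (g : G) : 'M[R]_n :=
  \matrix_(i, j) dot (ltrans g^-1%g (w j)) (w i).

Lemma range_coefE g j : ltrans g^-1%g (w j) = \sum_i range_coef g i j *: w i.
Proof.
rewrite [LHS]wE; last by rewrite -ltrans_conv we.
by apply: eq_bigr => i _; rewrite mxE.
Qed.

Lemma range_coef_orthogonal g : (range_coef g)^T *m range_coef g = 1%:M.
Proof.
apply/matrixP => i j; rewrite !mxE -[RHS]ow -(dot_ltrans cG g^-1%g).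
rewrite [X in dot X _]range_coefE dot_suml //; apply: eq_bigr => k _.
by rewrite dotZl // [dot (w k) _]dotC !mxE.
Qed.

Lemma range_coefM g h : range_coef (g * h)%g = range_coef g *m range_coef h.
Proof.
apply/matrixP => i j; rewrite !mxE.
have -> : ltrans (g * h)^-1%g (w j) = ltrans g^-1%g (ltrans h^-1%g (w j)).
  by apply: cfunP => u; rewrite !ltransE invgM mulgA.
rewrite range_coefE.
have -> : ltrans g^-1%g (\sum_k range_coef h k j *: w k) =
    \sum_k range_coef h k j *: ltrans g^-1%g (w k).
  by apply: cfunP => u; rewrite ltransE !cfun_sumE.
by rewrite dot_suml //; apply: eq_bigr => k _; rewrite dotZl // mulrC [range_coef g _ _]mxE.
Qed.

Lemma range_coef1 : range_coef 1%g = 1%:M.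
Proof.
apply/matrixP => i j; rewrite !mxE eq_sym -[RHS]ow; congr dot.
by apply: cfunP => u; rewrite ltransE invg1 mul1g.
Qed.

Lemma range_coef_continuous : continuous (fun g => map_mx cplx (range_coef g)).
Proof.
apply: continuous_mx => i j.
under [X in continuous X]funext => g do rewrite !mxE.
apply: continuous_comp1; last exact: cplx_continuous.
have cF : continuous (fun p : G * G => w j (p.1^-1 * p.2)%g * w i p.2).
  apply: continuous_mulr.
    apply: continuous_comp1; last exact: cfun_continuous.
    apply: mulg_continuous2; last exact: continuous_snd.
    by apply: invg_continuous1; exact: continuous_fst.
  by apply: continuous_comp1; [exact: continuous_snd|exact: cfun_continuous].
rewrite (_ : (fun g => _) = fun g => mean (section_fun cF g)).
  exact: (@continuous_mean R G cG _ cF).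
by apply/funext => g; congr mean; apply: cfunP.
Qed.

Lemma range_rep_exists :
  exists (rho : urep R G) (W : 'I_(rdim rho) -> cfun R G),
  (forall f, f ** e = f -> f = \sum_i dot f (W i) *: W i) /\
  forall g, exists r : 'M[R]_(rdim rho), rho g = map_mx cplx r /\
    forall j, ltrans g^-1%g (W j) = \sum_i r i j *: W i.
Proof.
unshelve eexists.
  apply: (@URep R G n (fun g => map_mx cplx (range_coef g))).
  - move=> g; apply/unitarymxP; apply: mulmx1C.
    have -> : (map_mx cplx (range_coef g)) ^t* = map_mx cplx (range_coef g)^T.
      by apply/matrixP => i j; rewrite !mxE conj_cplx.
    rewrite -(map_mxM (real_complex R)) range_coef_orthogonal.
    exact: (map_mx1 (real_complex R)).
  - by rewrite range_coef1; exact: (map_mx1 (real_complex R)).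
  - by move=> g h; rewrite range_coefM; exact: (map_mxM (real_complex R)).
  - exact: range_coef_continuous.
exists w; split => // g; exists (range_coef g); split => // j.
exact: range_coefE.
Qed.

End Construction.

Lemma conv_fixed_rep (e : cfun R G) :
  exists (rho : urep R G) (w : 'I_(rdim rho) -> cfun R G),
  (forall f, f ** e = f -> f = \sum_i dot f (w i) *: w i) /\
  forall g, exists r : 'M[R]_(rdim rho), rho g = map_mx cplx r /\
    forall j, ltrans g^-1%g (w j) = \sum_i r i j *: w i.
Proof.
have [n [w [ow we wE]]] := exists_orthonormal_basis cG e.
exact: range_rep_exists ow we wE.
Qed.

End RangeRepresentation.

(** * C*-algebras and vector-valued integration *)

Section CStarNorm.
Context {R : realType} {A : cstarAlgType R}.
Implicit Types (x y z a b : A) (u v : nat -> A).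

Lemma cnormZr (r : R) x : cnorm (cplx r *: x) = `|r| * cnorm x.
Proof. by rewrite cnormZ norm_cplx. Qed.

Lemma cnorm0 : cnorm (0 : A) = 0.
Proof. by rewrite -(scale0r 0) -cplx0 cnormZr normr0 mul0r. Qed.

Lemma cnormN x : cnorm (- x) = cnorm x.
Proof. by rewrite -scaleN1r -cplx1 -[- _]add0r -cplx0 -cplxB cnormZr sub0r normrN1 mul1r. Qed.

Lemma cnorm_ge0 x : 0 <= cnorm x.
Proof. have := cnormD x (- x); rewrite subrr cnorm0 cnormN; lra. Qed.

Lemma cnormB x y : cnorm (x - y) = cnorm (y - x).
Proof. by rewrite -cnormN opprB. Qed.

Lemma cnorm_dist x y z : cnorm (x - z) <= cnorm (x - y) + cnorm (y - z).
Proof. by rewrite (le_trans _ (cnormD _ _)) // addrA subrK. Qed.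

Lemma cnorm_dist_norm x y : `|cnorm x - cnorm y| <= cnorm (x - y).
Proof.
have := cnorm_dist x y 0; have := cnorm_dist y x 0.
by rewrite !subr0 (cnormB y x) ler_norml; lra.
Qed.

Lemma cnorm_sum I (r : seq I) (P : pred I) (F : I -> A) :
  cnorm (\sum_(i <- r | P i) F i) <= \sum_(i <- r | P i) cnorm (F i).
Proof.
elim/big_rec2: _ => [|i y z _ H]; first by rewrite cnorm0.
by rewrite (le_trans (cnormD _ _)) // lerD2l.
Qed.

Lemma cnorm_le0 x : cnorm x <= 0 -> x = 0.
Proof. by move=> x0; apply: cnorm0_eq0; apply/eqP; rewrite eq_le x0 cnorm_ge0. Qed.

Lemma star0 : star (0 : A) = 0.
Proof. by apply: (@addrI _ (star 0)); rewrite -starD !addr0. Qed.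

Lemma starN x : star (- x) = - star x.
Proof. by apply: (@addrI _ (star x)); rewrite -starD !subrr star0. Qed.

Lemma starB x y : star (x - y) = star x - star y.
Proof. by rewrite starD starN. Qed.

Lemma star1 : star (1 : A) = 1.
Proof. by rewrite -[LHS]mulr1 -{2}[1](starK (1 : A)) -starM mulr1 starK. Qed.

Lemma star_sum I (r : seq I) (P : pred I) (F : I -> A) :
  star (\sum_(i <- r | P i) F i) = \sum_(i <- r | P i) star (F i).
Proof. exact: (big_morph star (@starD _ A) star0). Qed.

Lemma cnorm1 : cnorm (1 : A) = 1.
Proof.
have := cnorm_star (1 : A); rewrite star1 mulr1 expr2 => /eqP.
rewrite -{1}[cnorm 1]mulr1 -subr_eq0 -mulrBr mulf_eq0 subr_eq0 => /orP[/eqP/cnorm0_eq0/eqP|/eqP<-//].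
by rewrite oner_eq0.
Qed.

(** By the C*-identity the square of [cnorm y] is at most [cnorm (star y) * cnorm y]. *)
Lemma cnorm_starE x : cnorm (star x) = cnorm x.
Proof.
have H y : cnorm y <= cnorm (star y).
  have [->|y0] := eqVneq y 0; first by rewrite star0.
  have yp : 0 < cnorm y.
    by rewrite lt0r cnorm_ge0 andbT; apply: contra_neq y0; exact: cnorm0_eq0.
  by rewrite -(ler_pM2r yp) -expr2 -cnorm_star cnormM.
by apply/eqP; rewrite eq_le -{2}[x]starK !H.
Qed.

Definition clim u l := forall e : R, 0 < e ->
  exists N, forall n, (N <= n)%N -> cnorm (u n - l) <= e.

Lemma clim_unique u l l' : clim u l -> clim u l' -> l = l'.
Proof.
move=> H H'; apply/eqP; rewrite -subr_eq0; apply/eqP; apply: cnorm_le0.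
apply/ler_addgt0Pr => e e0; have e2 : 0 < e / 2 by rewrite divr_gt0.
have [N HN] := H _ e2; have [M HM] := H' _ e2.
have := HN (maxn N M) (leq_maxl _ _); have := HM (maxn N M) (leq_maxr _ _).
have := cnorm_dist l (u (maxn N M)) l'; rewrite (cnormB l (u _)); lra.
Qed.

Lemma clim_cst l : clim (fun=> l) l.
Proof. by move=> e e0; exists 0%N => n _; rewrite subrr cnorm0 ltW. Qed.

Lemma climD u v l m : clim u l -> clim v m -> clim (fun n => u n + v n) (l + m).
Proof.
move=> H H' e e0; have e2 : 0 < e / 2 by rewrite divr_gt0.
have [N HN] := H _ e2; have [M HM] := H' _ e2; exists (maxn N M) => n.
rewrite geq_max => /andP[Nn Mn]; rewrite opprD addrACA (splitr e).
by rewrite (le_trans (cnormD _ _)) // lerD ?HN ?HM.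
Qed.

Lemma climM1 u v l m : clim u l -> clim v m ->
  (forall n, cnorm (u n) <= 1) -> clim (fun n => u n * v n) (l * m).
Proof.
move=> H H' u1 e e0; have e2 : 0 < e / 2 by rewrite divr_gt0.
have m0 : 0 < cnorm m + 1 by rewrite ltr_wpDl // cnorm_ge0.
have [N HN] := H _ (divr_gt0 e2 m0); have [M HM] := H' _ e2; exists (maxn N M) => n.
rewrite geq_max => /andP[Nn Mn].
have -> : u n * v n - l * m = u n * (v n - m) + (u n - l) * m.
  by rewrite mulrBr mulrBl addrA subrK.
rewrite (splitr e) (le_trans (cnormD _ _)) // lerD //.
  rewrite (le_trans (cnormM _ _)) // (le_trans _ (HM n Mn)) //.
  by rewrite ler_piMl ?cnorm_ge0.
rewrite (le_trans (cnormM _ _)) //.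
rewrite (@le_trans _ _ (e / 2 / (cnorm m + 1) * (cnorm m + 1))) //.
  by rewrite ler_pM ?cnorm_ge0 ?HN // lerDl.
by rewrite divfK // gt_eqF.
Qed.

Lemma clim_star u l : clim u l -> clim (fun n => star (u n)) (star l).
Proof. by move=> H e /H[N HN]; exists N => n /HN; rewrite -starB cnorm_starE. Qed.

Lemma climZ (r : R) u l : clim u l -> clim (fun n => cplx r *: u n) (cplx r *: l).
Proof.
move=> H e e0; have r0 : 0 < `|r| + 1 by rewrite ltr_wpDl.
have [N HN] := H _ (divr_gt0 e0 r0); exists N => n /HN {}HN.
rewrite -scalerBr cnormZr (@le_trans _ _ ((`|r| + 1) * (e / (`|r| + 1)))) //.
  by rewrite ler_pM ?cnorm_ge0 // lerDl.
by rewrite mulrC divfK // gt_eqF.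
Qed.

Lemma clim_shift u l : clim u l -> clim (fun n => u n.+1) l.
Proof. by move=> H e /H[N HN]; exists N => n Nn; apply: HN; exact: leqW. Qed.

Lemma clim_ext u v l : (forall n, u n = v n) -> clim u l -> clim v l.
Proof. by move=> E H e /H[N HN]; exists N => n /HN; rewrite E. Qed.

Lemma clim_complete u :
  (forall e : R, 0 < e -> exists N, forall n m, (N <= m)%N -> (N <= n)%N ->
     cnorm (u m - u n) < e) -> exists l, clim u l.
Proof.
move=> H; have [|l Hl] := @cnorm_complete R A u.
  by move=> e /H[N HN]; exists N => m n ? ?; exact: HN.
exists l => e e0; have /cvgrPdist_le/(_ _ e0)[N _ HN] := Hl.
exists N => n /HN /=; rewrite sub0r normrN ger0_norm ?cnorm_ge0 //.
Qed.

Section Sqrt.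
Context (a : A) (asa : star a = a) (a1 : cnorm a < 1).

(* Fixed point iteration for [l = (a^2 + l^2) / 2], that is [(1 - l)^2 = 1 - a^2]. *)
Fixpoint sqrt_iter n : A :=
  if n is m.+1 then cplx 2^-1 *: (a * a + sqrt_iter m * sqrt_iter m) else 0.

(** It serves twice: the ball of radius [r] is stable because [cnorm a ^+ 2 + r * r <= r * 2], and
    on it the iteration contracts by the factor [r]. *)
Let r : R := (1 + cnorm a ^+ 2) / 2.

Let r_lt1 : r < 1.
Proof.
rewrite /r ltr_pdivrMr // mul1r -ltrBrDl.
have := cnorm_ge0 a; have -> : 2 - 1 = 1 :> R by ring.
by move=> a0; rewrite expr_lt1.
Qed.

Let r_ge0 : 0 <= r.
Proof. by rewrite divr_ge0 // addr_ge0 // exprn_ge0 // cnorm_ge0. Qed.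

Lemma sqrt_iter_bound n : cnorm (sqrt_iter n) <= r.
Proof.
elim: n => [|n IH] /=; first by rewrite cnorm0.
rewrite cnormZr ger0_norm ?invr_ge0 // mulrC ler_pdivrMr //.
rewrite (le_trans (cnormD _ _)) //.
have h1 : cnorm (a * a) <= cnorm a ^+ 2 by rewrite expr2 cnormM.
have h2 : cnorm (sqrt_iter n * sqrt_iter n) <= r * r.
  by rewrite (le_trans (cnormM _ _)) // ler_pM ?cnorm_ge0.
have h3 : r * r <= 1 by rewrite mulr_ile1 // ltW.
have -> : r * 2 = 1 + cnorm a ^+ 2 by rewrite /r divfK // pnatr_eq0.
lra.
Qed.

Lemma sqrt_iter_contract n k :
  cnorm (sqrt_iter (n + k) - sqrt_iter n) <= r ^+ n.
Proof.
elim: n => [|n IH]; first by rewrite subr0 expr0 (le_trans (sqrt_iter_bound _)) // ltW.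
rewrite addSn /= -scalerBr cnormZr ger0_norm ?invr_ge0 // mulrC ler_pdivrMr //.
set y := sqrt_iter n; set y' := sqrt_iter (n + k).
have -> : a * a + y' * y' - (a * a + y * y) = y' * (y' - y) + (y' - y) * y.
  by rewrite opprD addrACA subrr add0r mulrBr mulrBl addrA subrK.
rewrite (le_trans (cnormD _ _)) // exprS mulr_natr mulr2n lerD //.
  by rewrite (le_trans (cnormM _ _)) // ler_pM ?cnorm_ge0 //; exact: sqrt_iter_bound.
by rewrite mulrC (le_trans (cnormM _ _)) // ler_pM ?cnorm_ge0 //; exact: sqrt_iter_bound.
Qed.

(** Stands in for the functional calculus: the iterates are self-adjoint and commute with [a], both
    properties pass to the limit [l], and [b = 1 - l]. *)
Lemma sqrt_exists : exists b, [/\ star b = b, a * b = b * a & a * a + b * b = 1].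
Proof.
have [l yl] : exists l, clim sqrt_iter l.
  apply: clim_complete => e e0; have e2 : 0 < e / 2 by rewrite divr_gt0.
  have : (fun n => r ^+ n) @ \oo --> (0 : R) by apply: cvg_expr; rewrite ger0_norm.
  move=> /cvgrPdist_lt/(_ _ e2)[N _ HN]; exists N => n m Nm Nn.
  have := HN N (leqnn N); rewrite /= sub0r normrN ger0_norm ?exprn_ge0 // => rN.
  have := cnorm_dist (sqrt_iter m) (sqrt_iter N) (sqrt_iter n).
  rewrite (cnormB (sqrt_iter N)).
  have := sqrt_iter_contract N (m - N); have := sqrt_iter_contract N (n - N).
  rewrite !subnKC //; lra.
have y1 n : cnorm (sqrt_iter n) <= 1.
  by rewrite (le_trans (sqrt_iter_bound n)) // ltW.
have star_l : star l = l.
  apply: clim_unique (clim_star yl) _; apply: clim_ext yl.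
  by elim=> [|n IH] /=; rewrite ?star0 // starZ conj_cplx starD !starM asa -IH.
have comm_l : a * l = l * a.
  have c n : a * sqrt_iter n = sqrt_iter n * a.
    elim: n => [|n IH] /=; first by rewrite mulr0 mul0r.
    by rewrite -scalerAr -scalerAl mulrDr mulrDl !mulrA IH -!mulrA IH.
  apply: clim_unique (climM1 (clim_cst a) yl (fun=> ltW a1)) _.
  apply: clim_ext (climM1 yl (clim_cst a) y1) => n.
  by rewrite c.
have lE : l = cplx 2^-1 *: (a * a + l * l).
  apply: clim_unique (clim_shift yl) _.
  exact: climZ (climD (clim_cst _) (climM1 yl yl y1)).
have l2 : l + l = a * a + l * l.
  rewrite -[RHS](scale1r (_ : A)) -cplx1 (_ : 1 = 2^-1 + 2^-1); last by field.
  by rewrite cplxD scalerDl -lE.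
exists (1 - l); split.
- by rewrite starB star1 star_l.
- by rewrite mulrBr mulrBl mulr1 mul1r comm_l.
- rewrite mulrBr mulr1 mulrBl mul1r opprB addrACA -opprD addrA.
  by rewrite [a * a + _]addrCA -l2 addrK.
Qed.
End Sqrt.
End CStarNorm.

(** * Contractivity of star-morphisms *)

Section StarMorphism.
Context {R : realType} {A B : cstarAlgType R} (phi : {lrmorphism A -> B}).
Context (phi_star : forall x, phi (star x) = star (phi x)).

(* If [a] is self-adjoint with norm less than 1, then [a = (u + u^* ) / 2] for
   the unitary [u = a + i sqrt (1 - a^2)], and [phi u] is unitary. *)
Lemma star_morphism_selfadjoint (a : A) : star a = a -> cnorm a < 1 ->
  cnorm (phi a) <= 1.
Proof.
move=> asa a1; have [b [bsb ab abE]] := sqrt_exists asa a1.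
pose c := phi a; pose d := phi b.
have cs : star c = c by rewrite -phi_star asa.
have ds : star d = d by rewrite -phi_star bsb.
have cd : c * d = d * c by rewrite -!rmorphM ab.
have cd1 : c * c + d * d = 1 by rewrite -!rmorphM -rmorphD abE rmorph1.
pose u := c + 'i *: d.
have us : star u = c - 'i *: d by rewrite starD starZ cs ds conjCi scaleNr.
have uu : star u * u = 1.
  have ii : 'i * 'i = -1 :> Cplx R by rewrite -expr2 sqrCi.
  rewrite us mulrDr !mulrBl -!scalerAr -!scalerAl scalerA ii scaleN1r opprK cd.
  by rewrite addrA subrK.
have u1 : cnorm u <= 1.
  rewrite -(@ler_pXn2r _ 2) ?nnegrE ?cnorm_ge0 //.
  by rewrite -cnorm_star uu cnorm1 expr1n.
have cE : c = cplx 2^-1 *: (u + star u).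
  rewrite us /u addrACA subrr addr0 -[in RHS](scale1r c) -scalerDl scalerA.
  by rewrite -cplx1 -cplxD -cplxM (_ : 2^-1 * (1 + 1) = 1) ?cplx1 ?scale1r //; field.
rewrite -/c cE cnormZr ger0_norm ?invr_ge0 // mulrC ler_pdivrMr // mul1r.
by rewrite (le_trans (cnormD _ _)) // cnorm_starE -[2]/(1 + 1) lerD.
Qed.

(** The C*-identity reduces to the self-adjoint [star x * x]; dividing by slightly more than the
    norm meets the strict bound required above. *)
Lemma star_morphism_contractive x : cnorm (phi x) <= cnorm x.
Proof.
have H (a : A) : star a = a -> cnorm (phi a) <= cnorm a.
  move=> asa; apply/ler_addgt0Pr => e e0.
  pose r := cnorm a + e; have r0 : 0 < r by rewrite ltr_wpDl // cnorm_ge0.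
  have := @star_morphism_selfadjoint (cplx r^-1 *: a).
  rewrite starZ conj_cplx asa cnormZr linearZ /= cnormZr gtr0_norm ?invr_gt0 //.
  rewrite !(mulrC r^-1) ltr_pdivrMr // mul1r ler_pdivrMr // mul1r; apply => //.
  by rewrite ltrDl.
rewrite -(@ler_pXn2r _ 2) ?nnegrE ?cnorm_ge0 // -!cnorm_star -phi_star -rmorphM.
by apply: H; rewrite starM starK.
Qed.
End StarMorphism.

Lemma cnorm_act (R : realType) (G : topGroupType) (A : cstarAlgType R)
  (alpha : cstar_system G A) g x : cnorm (alpha g x) = cnorm x.
Proof.
apply/eqP; rewrite eq_le; apply/andP; split.
  by apply: star_morphism_contractive; exact: act_star.
rewrite -{1}[x](act1 alpha) -(mulVg g) actM.
by apply: star_morphism_contractive; exact: act_star.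
Qed.

(** * Integration of continuous functions with values in [A] *)

Section Integral.
Context {R : realType} {G : topGroupType} (cG : compact [set: G]).
Context {A : cstarAlgType R}.
Implicit Types (F : G -> A) (s : seq (cfun R G * A)) (H : cfun R G).

Definition simple s (g : G) : A := \sum_(p <- s) cplx (p.1 g) *: p.2.
Definition simple_mean s : A := \sum_(p <- s) cplx (mean p.1) *: p.2.

(** One list approximates the means of [H] and of all coefficients at once, and for a finite average
    the bound is the triangle inequality. Applied to differences, it shows that [simple_mean]
    depends on the function only, not on the list. *)
Lemma simple_mean_bound s H : (forall g, cnorm (simple s g) <= H g) ->
  cnorm (simple_mean s) <= mean H.
Proof.
move=> sH; pose c := \sum_(p <- s) cnorm p.2 + 1.
have c0 : 0 < c by rewrite ltr_wpDl // sumr_ge0 // => p _; exact: cnorm_ge0.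
apply/ler_addgt0Pr => e e0; have ec : 0 < e / c by rewrite divr_gt0.
have [l l0 Hl] := mean_simultaneous cG (H :: map fst s) ec.
pose t := \sum_(p <- s) cplx (ravg l p.1 1%g) *: p.2.
have h1 : cnorm (simple_mean s - t) <= (e / c) * (c - 1).
  rewrite -sumrB (le_trans (cnorm_sum _ _ _)) // /c addrK mulr_sumr.
  rewrite big_seq_cond [leRHS]big_seq_cond; apply: ler_sum => p /andP[ps _].
  rewrite -scalerBl -cplxB cnormZr ler_wpM2r ?cnorm_ge0 // distrC.
  by apply: Hl; rewrite inE map_f ?orbT.
have h2 : cnorm t <= ravg l H 1%g.
  have -> : t = cplx (size l)%:R^-1 *: \sum_(a <- l) simple s (1 * a)%g.
    rewrite /simple exchange_big scaler_sumr; apply: eq_bigr => p _.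
    rewrite /ravg cplxM -scalerA -scaler_suml; congr (_ *: _).
    by rewrite cplx_sum.
  rewrite cnormZr ger0_norm ?invr_ge0 // /ravg ler_wpM2l ?invr_ge0 //.
  by rewrite (le_trans (cnorm_sum _ _ _)) // ler_sum.
have h3 := Hl H (mem_head _ _) 1%g.
have := cnormD (simple_mean s - t) t; rewrite subrK.
have -> : e = (e / c) * (c - 1) + e / c by field; rewrite gt_eqF.
by move: h3; rewrite ler_norml => /andP[? ?] ?; lra.
Qed.

Lemma simple_cat s1 s2 g : simple (s1 ++ s2) g = simple s1 g + simple s2 g.
Proof. by rewrite /simple big_cat. Qed.

Lemma simple_mean_cat s1 s2 :
  simple_mean (s1 ++ s2) = simple_mean s1 + simple_mean s2.
Proof. by rewrite /simple_mean big_cat. Qed.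

Lemma simple_map (phi : {additive A -> A}) s g :
  (forall (r : R) x, phi (cplx r *: x) = cplx r *: phi x) ->
  simple [seq (p.1, phi p.2) | p <- s] g = phi (simple s g).
Proof.
by move=> phiZ; rewrite /simple big_map raddf_sum; apply: eq_bigr => p _; rewrite /= phiZ.
Qed.

(** A relation, so that linearity, translation and bounded maps are checked on lists;
    [integral_exists] and [integral_unique] make it a function on continuous [F]. *)
Definition integral F (y : A) := forall e : R, 0 < e -> exists s,
  (forall g, cnorm (F g - simple s g) <= e) /\ cnorm (y - simple_mean s) <= e.

Lemma integral_map (phi : {additive A -> A}) (C : R) F y :
  (forall (r : R) x, phi (cplx r *: x) = cplx r *: phi x) ->
  (forall x, cnorm (phi x) <= C * cnorm x) ->
  integral F y -> integral (fun g => phi (F g)) (phi y).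
Proof.
move=> phiZ phiC Fy e e0; pose D := `|C| + 1.
have D0 : 0 < D by rewrite ltr_wpDl.
have [s [h1 h2]] := Fy _ (divr_gt0 e0 D0).
have phiD x : cnorm x <= e / D -> cnorm (phi x) <= e.
  move=> xe; rewrite (le_trans (phiC x)) //.
  rewrite (@le_trans _ _ (D * (e / D))) //; last by rewrite mulrC divfK // gt_eqF.
  rewrite (@le_trans _ _ (D * cnorm x)) ?ler_wpM2l ?(ltW D0) //.
  by rewrite ler_wpM2r ?cnorm_ge0 // /D; have := ler_norm C; lra.
exists [seq (p.1, phi p.2) | p <- s]; split => [g|].
  by rewrite simple_map // -raddfB phiD.
have -> : simple_mean [seq (p.1, phi p.2) | p <- s] = phi (simple_mean s).
  by rewrite /simple_mean big_map raddf_sum; apply: eq_bigr => p _; rewrite /= phiZ.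
by rewrite -raddfB phiD.
Qed.

Lemma integralD F1 F2 y1 y2 : integral F1 y1 -> integral F2 y2 ->
  integral (fun g => F1 g + F2 g) (y1 + y2).
Proof.
move=> H1 H2 e e0; have e2 : 0 < e / 2 by rewrite divr_gt0.
have [s1 [h1 k1]] := H1 _ e2; have [s2 [h2 k2]] := H2 _ e2.
exists (s1 ++ s2); split => [g|].
  rewrite simple_cat opprD addrACA (splitr e) (le_trans (cnormD _ _)) //.
  exact: lerD.
rewrite simple_mean_cat opprD addrACA (splitr e) (le_trans (cnormD _ _)) //.
exact: lerD.
Qed.

Lemma integral_scale (r : R) F y :
  integral F y -> integral (fun g => cplx r *: F g) (cplx r *: y).
Proof.
apply: (@integral_map ( *:%R (cplx r)) `|r|) => [r' x|x].
  by rewrite /= !scalerA mulrC.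
by rewrite /= cnormZr.
Qed.

Lemma integral0 : integral (fun=> 0) 0.
Proof.
move=> e e0; exists [::]; rewrite /simple_mean big_nil subrr cnorm0 ltW //.
by split => // g; rewrite /simple big_nil subrr cnorm0 ltW.
Qed.

Lemma integral_sum (I : Type) (r : seq I) (F : I -> G -> A) (y : I -> A) :
  (forall i, integral (F i) (y i)) ->
  integral (fun g => \sum_(i <- r) F i g) (\sum_(i <- r) y i).
Proof.
move=> H; elim: r => [|i r IH].
  by rewrite big_nil (_ : (fun _ => _) = fun=> 0); [exact: integral0|
    apply/funext => g; rewrite big_nil].
rewrite big_cons (_ : (fun _ => _) = fun g => F i g + \sum_(j <- r) F j g).
  exact: integralD.
by apply/funext => g; rewrite big_cons.
Qed.

Lemma integral_translate h F y :
  integral F y -> integral (fun g => F (h * g)%g) y.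
Proof.
move=> H e /H[s [h1 h2]]; exists [seq (ltrans h p.1, p.2) | p <- s]; split.
  by move=> g; rewrite /simple big_map; exact: h1.
rewrite /simple_mean big_map.
by under eq_bigr do rewrite /= mean_ltrans //.
Qed.

Lemma integral_bound F y H : integral F y -> (forall g, cnorm (F g) <= H g) ->
  cnorm y <= mean H.
Proof.
move=> Fy FH; apply/ler_addgt0Pr => e e0; have e2 : 0 < e / 2 by rewrite divr_gt0.
have [s [h1 h2]] := Fy _ e2.
have : cnorm (simple_mean s) <= mean (H + ccst (e / 2)).
  apply: simple_mean_bound => g; rewrite cfunDE ccstE.
  have := cnorm_dist (simple s g) (F g) 0; rewrite !subr0 cnormB.
  by have := h1 g; have := FH g; lra.
rewrite meanD // mean_cst //.
have := cnorm_dist y (simple_mean s) 0; rewrite !subr0; lra.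
Qed.

Lemma integral_unique F y y' : integral F y -> integral F y' -> y = y'.
Proof.
move=> Hy Hy'; apply/eqP; rewrite -subr_eq0; apply/eqP; apply: cnorm_le0.
rewrite -(mean0 cG); apply: (@integral_bound (fun=> 0)); last first.
  by move=> g; rewrite cnorm0.
have := integralD Hy (integral_scale (-1) Hy').
rewrite -[-1 in X in integral _ X]sub0r cplxB cplx0 cplx1 sub0r scaleN1r.
congr integral; apply/funext => g.
by rewrite -[-1]sub0r cplxB cplx0 cplx1 sub0r scaleN1r subrr.
Qed.

Definition ccontinuous F := forall g (e : R), 0 < e ->
  \forall h \near g, cnorm (F h - F g) < e.

(** A partition of unity: the bump at [t] is nonzero only where [F] is within [e] of [F t], so the
    weighted mean of the values [F t] stays within [e] of [F]. *)
Lemma simple_approximation F (e : R) : ccontinuous F -> 0 < e ->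
  exists s, forall g, cnorm (F g - simple s g) <= e.
Proof.
move=> cF e0.
have [T T0 HT] := compact_finite_cover cG (fun t => cF t e e0).
have cq t : continuous (fun g => Num.max 0 (e - cnorm (F g - F t)) : R).
  move=> g; apply/cvgrPdist_lt => d d0; apply: filterS (cF g d d0) => h Hh.
  have : `|cnorm (F g - F t) - cnorm (F h - F t)| < d.
    rewrite (le_lt_trans (cnorm_dist_norm _ _)) //.
    by rewrite opprB addrA subrK cnormB.
  move: (cnorm (F g - F t)) (cnorm (F h - F t)) => x y.
  rewrite ltr_norml => /andP[? ?].
  by rewrite ltr_norml; case: (leP 0 (e - x)); case: (leP 0 (e - y)); move=> ? ?;
    apply/andP; split; lra.
pose q t : cfun R G := mk_cfun (cq t).
have q0 t g : 0 <= q t g by rewrite /cfun_val /= le_max lexx.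
have qe t g : q t g != 0 -> cnorm (F g - F t) <= e.
  apply: contraNT; rewrite -ltNge => h; apply/eqP/max_idPl.
  by rewrite subr_le0 ltW.
pose Q : cfun R G := \sum_(t <- T) q t.
have Q0 g : 0 < Q g.
  rewrite /Q cfun_sumE; have [t tT /= Ht] := HT g.
  rewrite (big_rem t tT); apply: ltr_wpDr; first by apply: sumr_ge0 => i _; exact: q0.
  have : 0 < Num.max 0 (e - cnorm (F g - F t)) by rewrite lt_max subr_gt0 Ht orbT.
  by [].
have cp t : continuous (fun g => q t g / Q g : R).
  move=> g; apply: cvgM; first exact: cfun_continuous.
  by apply: cvgV; [rewrite gt_eqF|exact: cfun_continuous].
exists [seq (mk_cfun (cp t), F t) | t <- T] => g.
have -> : F g - simple [seq (mk_cfun (cp t), F t) | t <- T] g =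
   \sum_(t <- T) cplx (q t g / Q g) *: (F g - F t).
  rewrite /simple big_map.
  under [in RHS]eq_bigr do rewrite scalerBr.
  rewrite sumrB -scaler_suml -cplx_sum -mulr_suml -cfun_sumE -/Q divff ?gt_eqF //.
  by rewrite cplx1 scale1r.
rewrite (le_trans (cnorm_sum _ _ _)) //.
apply: (@le_trans _ _ (\sum_(t <- T) q t g / Q g * e)).
  apply: ler_sum => t _; rewrite cnormZr ger0_norm ?divr_ge0 ?(ltW (Q0 g)) //.
  have [->|/qe H] := eqVneq (q t g) 0; first by rewrite !mul0r.
  by rewrite ler_wpM2l // divr_ge0 ?(ltW (Q0 g)).
by rewrite -mulr_suml -mulr_suml -cfun_sumE -/Q divff ?gt_eqF // mul1r.
Qed.

Lemma simple_sub s : exists s', (forall g, simple s' g = - simple s g) /\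
  simple_mean s' = - simple_mean s.
Proof.
exists [seq (p.1, - p.2) | p <- s]; rewrite /simple /simple_mean.
by split=> [g|]; rewrite big_map -sumrN; apply: eq_bigr => p _; rewrite scalerN.
Qed.

Lemma integral_exists F : ccontinuous F -> exists y, integral F y.
Proof.
move=> cF.
have /choice[s Hs] n : exists s, forall g, cnorm (F g - simple s g) <= n.+1%:R^-1.
  by apply: simple_approximation => //; rewrite invr_gt0.
have dist n m : cnorm (simple_mean (s m) - simple_mean (s n)) <= m.+1%:R^-1 + n.+1%:R^-1.
  have [s' [h1 h2]] := simple_sub (s n).
  rewrite -h2 -simple_mean_cat -[leRHS](mean_cst cG).
  apply: simple_mean_bound => g; rewrite simple_cat h1 ccstE.
  rewrite (le_trans (cnorm_dist _ (F g) _)) // lerD //.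
  by rewrite cnormB.
have inv0 (e : R) : 0 < e -> exists N, forall n, (N <= n)%N -> n.+1%:R^-1 < e.
  move=> e0; exists (Num.truncn e^-1) => n Nn.
  rewrite invf_plt ?posrE // (lt_le_trans (truncnS_gt _)) // ler_nat ltnS //.
have [y Hy] : exists y, clim (fun n => simple_mean (s n)) y.
  apply: clim_complete => e e0; have e2 : 0 < e / 2 by rewrite divr_gt0.
  have [N HN] := inv0 _ e2; exists N => n m Nm Nn.
  rewrite (le_lt_trans (dist _ _)) // (splitr e) ltrD //; exact: HN.
exists y => e e0; have [N HN] := inv0 _ e0; have [M HM] := Hy _ e0.
exists (s (maxn N M)); split => [g|].
  by rewrite (le_trans (Hs _ g)) // ltW // HN // leq_maxl.
by rewrite cnormB HM // leq_maxr.
Qed.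

End Integral.

(** * Representations and covariant vectors *)

Section UnitaryMatrices.
Context {C : numClosedFieldType}.
Local Open Scope sesquilinear_scope.

Lemma adjM m n p (X : 'M[C]_(m, n)) (Y : 'M[C]_(n, p)) :
  (X *m Y) ^t* = Y ^t* *m X ^t*.
Proof. by rewrite trmx_mul map_mxM. Qed.

Lemma adjB m n (X Y : 'M[C]_(m, n)) : (X - Y) ^t* = X ^t* - Y ^t*.
Proof. by apply/matrixP => i j; rewrite !mxE rmorphB. Qed.

Lemma adj1 n : (1%:M : 'M[C]_n) ^t* = 1%:M.
Proof. by rewrite trmx1 map_mx1. Qed.

Lemma adj_mul_eq0 m n (X : 'M[C]_(m, n)) : X ^t* *m X = 0 -> X = 0.
Proof.
move=> XX; apply/matrixP => i j; rewrite mxE.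
have /eqP := congr1 (fun M : 'M[C]_n => M j j) XX; rewrite !mxE.
rewrite psumr_eq0 => [/allP/(_ i (mem_index_enum _))|k _]; last first.
  by rewrite !mxE mulrC mul_conjC_ge0.
by rewrite !mxE /= mulf_eq0 conjC_eq0 orbb => /eqP.
Qed.

(** Gram-Schmidt on the row space of [P] yields the isometry. The strict drop in dimension drives
    the induction in [covariant_spectral]. *)
Lemma projection_factor n (P : 'M[C]_n) : P ^t* = P -> P *m P = P ->
  exists k (p : 'M[C]_(n, k)),
  [/\ p ^t* *m p = 1%:M, p *m p ^t* = P & P != 1%:M -> (k < n)%N].
Proof.
move=> Pa PP; pose U := schmidt (row_base P).
have Uu : U *m U ^t* = 1%:M.
  by apply/unitarymxP; apply: schmidt_unitarymx; exact: rank_leq_col.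
have UP : (U :=: P)%MS.
  by apply: eqmx_trans (eq_row_base P); apply: eqmx_schmidt_free; exact: row_base_free.
have [X PX] : exists X, P = X *m U by apply/submxP; rewrite UP.
have [Y UY] : exists Y, U = Y *m P by apply/submxP; rewrite UP.
have PUU : P *m U ^t* *m U = P.
  suff K Q : Q = X *m U -> Q *m U ^t* *m U = Q by exact: K.
  by move=> ->; rewrite -!mulmxA [U *m (_ *m _)]mulmxA Uu mul1mx.
have UPU : U *m P = U by rewrite {1}UY -mulmxA PP -UY.
exists (\rank P), (U ^t*); split; first by rewrite trmxCK.
  rewrite trmxCK -{2}UPU; have := congr1 (fun M => M ^t*) PUU.
  by rewrite !adjM !trmxCK Pa mulmxA.
move=> P1; rewrite ltn_neqAle rank_leq_row andbT; apply: contraNneq P1 => rP.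
have Pu : P \in unitmx by rewrite -row_free_unit /row_free rP.
by rewrite -(mulKmx Pu P) PP mulVmx.
Qed.
End UnitaryMatrices.

(** * Schur's lemma *)

Section Representations.
Context {R : realType} {G : topGroupType}.
Implicit Types pi rho : urep R G.
Local Open Scope sesquilinear_scope.
Local Notation C := (Cplx R).

Lemma rep_adj pi g : (pi g) ^t* *m pi g = 1%:M.
Proof. by apply: mulmx1C; apply/unitarymxP; exact: rep_unitary. Qed.

Lemma rep_adj2 pi g : pi g *m (pi g) ^t* = 1%:M.
Proof. by apply/unitarymxP; exact: rep_unitary. Qed.

Lemma rep_inv pi g : pi g^-1%g = (pi g) ^t*.
Proof.
rewrite -[LHS]mulmx1 -(rep_adj2 pi g) mulmxA -repM mulVg rep1 mul1mx //.
Qed.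

Definition intertwiner pi rho (T : 'M[C]_(rdim rho, rdim pi)) :=
  forall g, rho g *m T = T *m pi g.
Arguments intertwiner : clear implicits.

Lemma intertwiner_adj pi rho T :
  intertwiner pi rho T -> intertwiner rho pi (T ^t*).
Proof.
move=> HT g; have := congr1 (fun M => M ^t*) (HT g^-1%g).
by rewrite !adjM !rep_inv !trmxCK => ->.
Qed.

Lemma intertwiner_mul pi rho tau S T :
  intertwiner rho tau S -> intertwiner pi rho T -> intertwiner pi tau (S *m T).
Proof. by move=> HS HT g; rewrite mulmxA HS -mulmxA HT mulmxA. Qed.

Lemma schur_scalar pi T : irreducible pi -> intertwiner pi pi T ->
  exists c, T = c%:M.
Proof.
(* [eigenvalueP] concerns row vectors while representations act on columns, hence [T^T]. *)
move=> [n0 irr] HT; have [a /eigenvalueP[v vT v0]] := eigenvalue_closed T^T n0.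
pose f : 'End('cV[C]_(rdim pi)) := linfun (mulmx (T - a%:M)).
have kerE w : (w \in lker f) = (T *m w == a *: w).
  by rewrite memv_ker lfunE /= mulmxBl mul_scalar_mx subr_eq0.
have [g w|W0|Wf] := irr (lker f).
- rewrite !kerE => /eqP Tw; rewrite mulmxA -HT -mulmxA Tw -scalemxAr //.
- have : v^T \in lker f by rewrite kerE -[T]trmxK -trmx_mul vT linearZ.
  by rewrite W0 memv0 -(inj_eq trmx_inj) trmxK trmx0 (negbTE v0).
exists a; apply/matrixP => i j.
have : delta_mx j 0 \in lker f by rewrite Wf memvf.
rewrite kerE -colE => /eqP/matrixP/(_ i 0); rewrite !mxE eqxx andbT mulr_natr => ->.
by rewrite eq_sym.
Qed.

(** Both products of [T] with its adjoint are the same nonnegative scalar; dividing [T] by its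
    square root gives a unitary. *)
Lemma schur_equivalent pi rho T : irreducible pi -> irreducible rho ->
  intertwiner pi rho T -> T != 0 -> equivalent pi rho.
Proof.
move=> ipi irho HT T0.
have [c cE] := schur_scalar ipi (intertwiner_mul (intertwiner_adj HT) HT).
have [d dE] := schur_scalar irho (intertwiner_mul HT (intertwiner_adj HT)).
have cd : c = d.
  have : T *m (T ^t* *m T) = T *m T ^t* *m T by rewrite mulmxA.
  rewrite cE dE mul_mx_scalar mul_scalar_mx => /eqP.
  by rewrite -subr_eq0 -scalerBl scaler_eq0 (negbTE T0) orbF subr_eq0 => /eqP.
have c0 : 0 <= c.
  case: ipi => n0 _; have := congr1 (fun M : 'M[C]_(rdim pi) => M (Ordinal n0) (Ordinal n0)) cE.
  rewrite !mxE eqxx mulr1n => <-; apply: sumr_ge0 => k _.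
  by rewrite !mxE mulrC mul_conjC_ge0.
have cn : c != 0.
  apply: contra_neq T0 => c00; apply: adj_mul_eq0.
  by rewrite cE c00; apply/matrixP => i j; rewrite !mxE mul0rn.
pose r := sqrtC c; have r0 : r != 0 by rewrite sqrtC_eq0.
have rr : r^-1 * r^-1 * c = 1 by rewrite -[c]sqrtCK -/r -invfM -expr2 mulVf // sqrf_eq0.
have radj : (r^-1 *: T) ^t* = r^-1 *: T ^t*.
  apply/matrixP => i j; rewrite !mxE rmorphM /= geC0_conj // invr_ge0 sqrtC_ge0 //.
exists (r^-1 *: T); first split.
- rewrite radj -scalemxAl -scalemxAr scalerA cE.
  by apply/matrixP => i j; rewrite !mxE mulrnAr rr.
- by move=> g; rewrite -scalemxAr HT -scalemxAl.
- rewrite radj -scalemxAl -scalemxAr scalerA dE -cd.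
  by apply/matrixP => i j; rewrite !mxE mulrnAr rr.
Qed.

End Representations.
Arguments intertwiner {R G} pi rho T.

(** * Subrepresentations and invariant projections *)

Section Subrepresentations.
Context {R : realType} {G : topGroupType}.
Implicit Types pi rho : urep R G.
Local Open Scope sesquilinear_scope.
Local Notation C := (Cplx R).

Lemma rep_entry_continuous pi i j : continuous (fun g => pi g i j).
Proof.
move=> g N /= nN.
have nS : nbhs (pi g) [set M | N (M i j)].
  exists (fun k l => if (k == i) && (l == j) then N else setT).
    move=> k l; case: ifP => [/andP[/eqP-> /eqP->]//|_]; exact: filterT.
  by move=> M /(_ i j); rewrite !eqxx.
exact: (@rep_continuous _ _ pi g _ nS).
Qed.

Lemma continuous_sumC (T : topologicalType) (I : Type) (r : seq I) (F : I -> T -> C) :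
  (forall i, continuous (F i)) -> continuous (fun t => \sum_(i <- r) F i t).
Proof.
move=> cF; elim: r => [|i r IH].
  rewrite (_ : (fun t => _) = fun=> 0); first exact: cst_continuous.
  by apply/funext => t; rewrite big_nil.
rewrite (_ : (fun t => _) = fun t => F i t + \sum_(j <- r) F j t).
  by move=> t; apply: cvgD; [exact: cF|exact: IH].
by apply/funext => t; rewrite big_cons.
Qed.

Lemma subrep_continuous pi k (p : 'M[C]_(rdim pi, k)) :
  continuous (fun g => p ^t* *m pi g *m p).
Proof.
apply: continuous_mx => i j.
under [X in continuous X]funext => g do rewrite mxE.
apply: continuous_sumC => l.
under [X in continuous X]funext => g do rewrite mxE.
move=> g; apply: cvgM; last exact: cvg_cst.
move: g; apply: continuous_sumC => m g.
by apply: cvgM; [exact: cvg_cst|exact: rep_entry_continuous].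
Qed.

(** Compression by [p] is multiplicative because [pi] preserves the range of [p]; [q] is [p] with
    its column dimension read as [rdim rho]. *)
Lemma subrep_exists pi k (p : 'M[C]_(rdim pi, k)) : p ^t* *m p = 1%:M ->
  intertwiner pi pi (p *m p ^t*) ->
  exists (rho : urep R G) (q : 'M[C]_(rdim pi, rdim rho)),
  [/\ rdim rho = k, isometric_intertwiner q & q *m q ^t* = p *m p ^t*].
Proof.
move=> pp Hp.
have pip g : pi g *m p = p *m (p ^t* *m pi g *m p).
  by rewrite !mulmxA -Hp -!mulmxA pp mulmx1.
have subM g h : p ^t* *m pi (g * h)%g *m p =
    (p ^t* *m pi g *m p) *m (p ^t* *m pi h *m p).
  by rewrite repM mulmxA -[LHS]mulmxA (pip h) mulmxA.
have sub1 : p ^t* *m pi 1%g *m p = 1%:M by rewrite rep1 mulmx1.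
have subU g : p ^t* *m pi g *m p \is unitarymx.
  apply/unitarymxP; rewrite -[RHS]sub1 -(mulgV g) subM; congr (_ *m _).
  by rewrite !adjM trmxCK rep_inv -mulmxA.
by exists (URep subU sub1 subM (@subrep_continuous pi k p)), p.
Qed.

Lemma invariant_projection pi (W : {vspace 'cV[C]_(rdim pi)}) :
  (forall g v, v \in W -> pi g *m v \in W) -> W != 0%VS -> W != fullv ->
  exists P : 'M[C]_(rdim pi),
  [/\ P ^t* = P, P *m P = P, intertwiner pi pi P, P != 0 & P != 1%:M].
Proof.
move=> HW W0 W1; pose V := \matrix_(i < \dim W) ((vbasis W)`_i)^T.
have VW r : (r <= V)%MS -> r^T \in W.
  move=> /submxP[z ->]; rewrite mulmx_sum_row linear_sum; apply: memv_suml => i _.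
  by rewrite linearZ /= rowK trmxK memvZ // vbasis_mem // mem_nth // size_tuple.
have WV v : v \in W -> (v^T <= V)%MS.
  move=> vW; rewrite (coord_vbasis vW) linear_sum; apply: summx_sub => i _.
  rewrite linearZ /=; apply: scalemx_sub.
  by rewrite (_ : _^T = row i V) ?row_sub // rowK.
pose U := schmidt (row_base V).
have Uu : U *m U ^t* = 1%:M.
  by apply/unitarymxP; apply: schmidt_unitarymx; exact: rank_leq_col.
have UV : (U :=: V)%MS.
  by apply: eqmx_trans (eq_row_base V); apply: eqmx_schmidt_free; exact: row_base_free.
pose p := U^T; have pp : p ^t* *m p = 1%:M.
  have -> : p ^t* = (U ^t*)^T by apply/matrixP => i j; rewrite !mxE.
  by rewrite -trmx_mul Uu trmx1.
pose P := p *m p ^t*.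
have Pa : P ^t* = P by rewrite adjM trmxCK.
have PP : P *m P = P by rewrite mulmxA -(mulmxA p) pp mulmx1.
have piP g : P *m (pi g *m P) = pi g *m P.
  have [Z HZ] : exists Z, pi g *m p = p *m Z.
    have : (U *m (pi g)^T <= U)%MS.
      apply/row_subP => i; rewrite row_mul UV -[X in (X <= _)%MS]trmxK.
      apply: WV; rewrite trmx_mul trmxK; apply: HW; apply: VW.
      rewrite -UV; exact: row_sub.
    by move=> /submxP[Z HZ]; exists Z^T; rewrite -[LHS]trmxK trmx_mul trmxK HZ trmx_mul.
  have -> : pi g *m P = p *m (Z *m p ^t*) by rewrite /P mulmxA HZ mulmxA.
  by rewrite /P -mulmxA (mulmxA (p ^t*)) pp mul1mx.
(* Invariance under [g^-1], read through adjoints, gives [P *m pi g *m P = P *m pi g]. *)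
have HP : intertwiner pi pi P.
  move: P Pa piP {PP} => Q Qa QpQ g; have := congr1 (fun M => M ^t*) (QpQ g^-1%g).
  by rewrite !adjM Qa rep_inv trmxCK => <-; rewrite -mulmxA QpQ.
exists P; split => //.
- apply: contra_neq W0 => P0; apply/eqP; rewrite -subv0; apply/subvP => v vW.
  have [z vz] : exists z, v^T = z *m U by apply/submxP; rewrite UV WV.
  have : P *m v = v.
    by rewrite -[v]trmxK vz trmx_mul /P -mulmxA (mulmxA (p ^t*)) pp mul1mx.
  by rewrite P0 mul0mx => <-; rewrite mem0v.
- apply: contra_neq W1 => P1; apply/eqP; rewrite eqEsubv subvf /=.
  apply/subvP => v _; rewrite -[v]mul1mx -P1 -mulmxA -[X in X \in _]trmxK.
  by apply: VW; rewrite trmx_mul trmxK -UV submxMl.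
Qed.

End Subrepresentations.

(** * Matrices over [A], legs and the tensor flip *)

Section MatrixOperations.
Context {R : realType} {A : cstarAlgType R}.
Local Open Scope sesquilinear_scope.
Local Notation C := (Cplx R).
Local Notation one_tens := (@one_tens R A).

Lemma one_tensM m n p (X : 'M[C]_(m, n)) (Y : 'M[C]_(n, p)) :
  one_tens (X *m Y) = one_tens X *m one_tens Y.
Proof. exact: (map_mxM (GRing.in_alg A)). Qed.

Lemma one_tensD m n (X Y : 'M[C]_(m, n)) :
  one_tens (X + Y) = one_tens X + one_tens Y.
Proof. exact: (raddfD (map_mx (GRing.in_alg A))). Qed.

Lemma one_tens1 n : one_tens (1%:M : 'M[C]_n) = 1%:M.
Proof. exact: (map_mx1 (GRing.in_alg A)). Qed.

Lemma one_tens0 m n : one_tens (0 : 'M[C]_(m, n)) = 0.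
Proof. exact: (map_mx0 (GRing.in_alg A)). Qed.

Lemma one_tens_sum m n (I : Type) (r : seq I) (P : pred I) (F : I -> 'M[C]_(m, n)) :
  one_tens (\sum_(i <- r | P i) F i) = \sum_(i <- r | P i) one_tens (F i).
Proof. exact: (raddf_sum (map_mx (GRing.in_alg A))). Qed.

Lemma one_tens_adj m n (X : 'M[C]_(m, n)) : adjmx (one_tens X) = one_tens (X ^t*).
Proof. by apply/matrixP => i j; rewrite !mxE /= starZ star1. Qed.

Lemma adjmxM m n p (x : 'M[A]_(m, n)) (y : 'M[A]_(n, p)) :
  adjmx (x *m y) = adjmx y *m adjmx x.
Proof.
apply/matrixP => i j; rewrite !mxE star_sum; apply: eq_bigr => k _.
by rewrite !mxE starM.
Qed.

Lemma adjmx_sum m n (I : Type) (r : seq I) (P : pred I) (F : I -> 'M[A]_(m, n)) :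
  adjmx (\sum_(i <- r | P i) F i) = \sum_(i <- r | P i) adjmx (F i).
Proof.
apply: (big_morph (@adjmx R A m n)) => [x y|]; apply/matrixP => i j.
  by rewrite !mxE starD.
by rewrite !mxE star0.
Qed.

(** [A] need not be commutative, so the order of the legs matters: unit entries commute with
    everything, and those of [x] stay on the left. *)
Lemma legs_mul m n (x : 'M[A]_m) (y : 'M[A]_n) :
  leg12 n x *m leg13 m y = x *t y.
Proof.
apply/matrixP => i j; case: (mxtens_indexP i) => i1 i2.
case: (mxtens_indexP j) => j1 j2; rewrite tensmxE mxE.
rewrite (reindex (@mxtens_index m n)) /=; last first.
  by exists (@mxtens_unindex m n) => k _; rewrite ?mxtens_indexK ?mxtens_unindexK.
rewrite (bigD1 (j1, i2)) //= big1 ?addr0 => [|[k1 k2]].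
  by rewrite /leg12 /leg13 !tensmxE !mxE !eqxx mulr1 mul1r.
rewrite xpair_eqE negb_and /leg12 /leg13 !tensmxE !mxE.
by case: (k1 == j1); case: (i2 =P k2) => [->|]; rewrite ?eqxx //= ?(mulr0, mul0r).
Qed.

Lemma flip_indexK m n : cancel (@flip_index m n) (@flip_index n m).
Proof. by move=> a; rewrite /flip_index mxtens_indexK -surjective_pairing mxtens_unindexK. Qed.

Lemma flip_indexE m n (i : 'I_n) (j : 'I_m) :
  flip_index (mxtens_index (i, j)) = mxtens_index (j, i).
Proof. by rewrite /flip_index mxtens_indexK. Qed.

Lemma sum_flip_index (V : nmodType) m n (F : 'I_(m * n) -> V) :
  \sum_i F i = \sum_i F (flip_index i).
Proof.
by apply: reindex; exists (@flip_index n m) => i _; rewrite flip_indexK.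
Qed.

Lemma tensor_flipM m n (x y : 'M[A]_(m * n)) :
  tensor_flip (x *m y) = tensor_flip x *m tensor_flip y.
Proof.
apply/matrixP => i j; rewrite !mxE sum_flip_index.
by apply: eq_bigr => k _; rewrite !mxE.
Qed.

Lemma tensor_flip_adj m n (x : 'M[A]_(m * n)) :
  tensor_flip (adjmx x) = adjmx (tensor_flip x).
Proof. by apply/matrixP => i j; rewrite !mxE. Qed.

(** The bridge between the symmetry of [omega] and commuting entries, crossed in both directions. *)
Lemma tensor_flip_tens m n (x : 'M[A]_m) (y : 'M[A]_n) :
  tensor_flip (x *t y) = y *t x <->
  forall a b c d, x a b * y c d = y c d * x a b.
Proof.
split=> [H a b c d|H].
  have := congr1 (fun M : 'M[A]_(n * m) => M (mxtens_index (c, a)) (mxtens_index (d, b))) H.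
  by rewrite mxE !flip_indexE !tensmxE.
apply/matrixP => i j; case: (mxtens_indexP i) => i1 i2.
by case: (mxtens_indexP j) => j1 j2; rewrite mxE !flip_indexE !tensmxE.
Qed.

End MatrixOperations.

(** * Extension of a choice of isometries to all representations *)

Section Choices.
Context {R : realType} {G : topGroupType} {A : cstarAlgType R}.
Context (Ghat : irr_system R G) (s : @isometry_choice R G A Ghat).
Local Open Scope sesquilinear_scope.
Local Notation C := (Cplx R).
Local Notation one_tens := (@one_tens R A).

(** By Schur's lemma and the uniqueness of representatives, either [T] is zero or [i = j] and [T] is
    scalar. *)
Lemma choice_intertwiner (i j : Ghat) (T : 'M[C]_(rdim (irr j), rdim (irr i))) :
  intertwiner (irr i) (irr j) T -> s j *m one_tens T = one_tens T *m s i.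
Proof.
have [-> _|T0 HT] := eqVneq T 0; first by rewrite one_tens0 mulmx0 mul0mx.
have ij := irr_inj (schur_equivalent (irr_irreducible i) (irr_irreducible j) HT T0).
subst j; have [c ->] := schur_scalar (irr_irreducible i) HT.
apply/matrixP => a b; rewrite !mxE (bigD1 b) //= big1 ?addr0 => [|k kb].
  rewrite [RHS](bigD1 a) //= big1 ?addr0 => [|k ka].
    by rewrite !mxE !eqxx mulr1n /= mulr_algr mulr_algl.
  by rewrite !mxE eq_sym (negbTE ka) mulr0n /= scale0r mul0r.
by rewrite !mxE (negbTE kb) mulr0n /= scale0r mulr0.
Qed.

Lemma isometric_overlap (pi : urep R G) (i j : Ghat)
    (v : 'M[C]_(rdim pi, rdim (irr i))) (w : 'M[C]_(rdim pi, rdim (irr j))) :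
  isometric_intertwiner v -> isometric_intertwiner w ->
  s j *m one_tens (w ^t* *m v) = one_tens (w ^t* *m v) *m s i.
Proof.
move=> [_ Hv] [_ Hw]; apply: choice_intertwiner.
by apply: intertwiner_mul Hv; exact: intertwiner_adj.
Qed.

(** Inserting the identity of the other decomposition produces overlaps of [v k] and [w l]; these
    intertwine irreducibles, so they slide past [s]. *)
Lemma extends_choice_unique (pi : urep R G) (t t' : 'M[A]_(rdim pi)) :
  extends_choice s t -> extends_choice s t' -> t = t'.
Proof.
move=> [r [sg [v [Hv v1 ->]]]] [r' [sg' [w [Hw w1 ->]]]].
transitivity (\sum_k \sum_l one_tens (w l) *m s (sg' l) *m
    one_tens ((w l) ^t* *m v k) *m one_tens ((v k) ^t*)).
  apply: eq_bigr => k _; rewrite -{1}[v k]mul1mx -w1 mulmx_suml one_tens_sum.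
  rewrite !mulmx_suml; apply: eq_bigr => l _.
  rewrite -(mulmxA (w l)) one_tensM -(mulmxA (one_tens (w l))).
  by rewrite -isometric_overlap // mulmxA.
rewrite exchange_big; apply: eq_bigr => l _ /=.
rewrite -[X in _ = _ *m one_tens X]mulmx1 -v1 mulmx_sumr one_tens_sum mulmx_sumr.
apply: eq_bigr => k _.
by rewrite -[LHS]mulmxA -one_tensM -(mulmxA ((w l) ^t*)).
Qed.

Lemma extends_choice_unitary (pi : urep R G) (t : 'M[A]_(rdim pi)) :
  (forall i, s i *m adjmx (s i) = 1%:M) -> extends_choice s t ->
  t *m adjmx t = 1%:M.
Proof.
move=> ss [r [sg [v [Hv v1 ->]]]]; rewrite adjmx_sum mulmx_suml.
transitivity (\sum_k \sum_l one_tens (v k *m (v k) ^t*) *m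
   one_tens (v l *m (v l) ^t*)).
  apply: eq_bigr => k _; rewrite mulmx_sumr; apply: eq_bigr => l _.
  rewrite !adjmxM !one_tens_adj trmxCK.
  have H := isometric_overlap (Hv l) (Hv k).
  rewrite !one_tensM; move: (one_tens (v k)) (one_tens ((v l) ^t*)) => X Y.
  have -> : X *m s (sg k) *m one_tens ((v k) ^t*) *m
      (one_tens (v l) *m (adjmx (s (sg l)) *m Y)) =
      X *m (s (sg k) *m one_tens ((v k) ^t* *m v l)) *m adjmx (s (sg l)) *m Y.
    by rewrite one_tensM !mulmxA.
  rewrite H one_tensM.
  by rewrite -!mulmxA (mulmxA (s _)) ss mul1mx.
rewrite -[RHS]mulmx1 -!one_tens1 -v1 one_tens_sum mulmx_suml.
by apply: eq_bigr => k _; rewrite mulmx_sumr.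
Qed.

(** Permuting the rows of each [v k] decomposes the flipped tensor product with the same
    constituents. *)
Lemma extends_choice_flip (pi rho : urep R G) (t : 'M[A]_(rdim pi * rdim rho)) :
  extends_choice s (pi := tensor_rep pi rho) t ->
  extends_choice s (pi := tensor_rep rho pi) (tensor_flip t).
Proof.
move=> [r [sg [v [Hv v1 tE]]]].
pose w k : 'M[C]_(rdim rho * rdim pi, rdim (irr (sg k))) :=
  \matrix_(a, b) v k (flip_index a) b.
have tens g a b : (tensor_rep rho pi) g a b =
    (tensor_rep pi rho) g (flip_index a) (flip_index b).
  case: (mxtens_indexP a) => a1 a2; case: (mxtens_indexP b) => b1 b2.
  by rewrite !flip_indexE [LHS]tensmxE [RHS]tensmxE mulrC.
exists r, sg, w; split.
- move=> k; have [vv Hk] := Hv k; split => [|g].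
    rewrite -vv; apply/matrixP => a b; rewrite !mxE [RHS]sum_flip_index.
    by apply: eq_bigr => c _; rewrite !mxE.
  have /matrixP Hkg := Hk g; apply/matrixP => a b.
  have := Hkg (flip_index a) b; rewrite !mxE => H.
  transitivity (\sum_c v k (flip_index a) c * irr (sg k) g c b); last first.
    by apply: eq_bigr => c _; rewrite !mxE.
  rewrite -H [RHS]sum_flip_index; apply: eq_bigr => c _.
  by rewrite tens !mxE.
- apply/matrixP => a b; have /matrixP/(_ (flip_index a) (flip_index b)) := v1.
  rewrite !summxE !mxE (can_eq (@flip_indexK _ _)) => <-.
  apply: eq_bigr => k _; rewrite !mxE; apply: eq_bigr => c _.
  by rewrite !mxE.
- rewrite tE; apply/matrixP => a b; rewrite mxE !summxE; apply: eq_bigr => k _.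
  rewrite !mxE; apply: eq_bigr => c _; rewrite !mxE; congr (_ * _).
  by apply: eq_bigr => d _; rewrite !mxE.
Qed.

End Choices.

(** * Covariant columns and density of their entries *)

Section Covariance.
Context {R : realType} {G : topGroupType} {A : cstarAlgType R}.
Context (alpha : cstar_system G A) (Ghat : irr_system R G).
Local Open Scope sesquilinear_scope.
Local Notation C := (Cplx R).
Local Notation one_tens := (@one_tens R A).

(* [A2 alpha] is the case of a square matrix [x]. *)
Definition covariant (pi : urep R G) n (x : 'M[A]_(rdim pi, n)) :=
  forall g, one_tens (pi g) *m map_mx (alpha g) x = x.

Lemma act_one_tens g m n (T : 'M[C]_(m, n)) :
  map_mx (alpha g) (one_tens T) = one_tens T.
Proof. by apply/matrixP => i j; rewrite !mxE linearZ /= rmorph1. Qed.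

Lemma act_mulmx g m n p (X : 'M[A]_(m, n)) (Y : 'M[A]_(n, p)) :
  map_mx (alpha g) (X *m Y) = map_mx (alpha g) X *m map_mx (alpha g) Y.
Proof. exact: (map_mxM (alpha g)). Qed.

Lemma covariant_intertwiner pi rho n T (x : 'M[A]_(rdim pi, n)) :
  intertwiner pi rho T -> covariant x -> covariant (one_tens T *m x).
Proof.
move=> HT Hx g; rewrite act_mulmx act_one_tens mulmxA -one_tensM HT one_tensM.
by rewrite -mulmxA Hx.
Qed.

(** The linear span of the entries of all [A2], scalars being absorbed by [spectral_elt_scale]. The
    inductive form gives induction over sums whose terms come from matrices of different sizes. *)
Inductive spectral_elt : A -> Prop :=
| spectral0 : spectral_elt 0
| spectralD (i : Ghat) (m : 'M[A]_(rdim (irr i))) a b x :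
    A2 alpha m -> spectral_elt x -> spectral_elt (m a b + x).

Lemma spectral_elt_add x y :
  spectral_elt x -> spectral_elt y -> spectral_elt (x + y).
Proof.
elim=> [|i m a b {}x Hm _ IH] Hy; first by rewrite add0r.
by rewrite -addrA; apply: spectralD Hm (IH Hy).
Qed.

Lemma spectral_elt_scale (c : C) x : spectral_elt x -> spectral_elt (c *: x).
Proof.
elim=> [|i m a b {}x Hm _ IH]; first by rewrite scaler0; exact: spectral0.
rewrite scalerDr; have -> : c *: m a b = (one_tens c%:M *m m) a b.
  rewrite !mxE (bigD1 a) //= big1 ?addr0 => [|k ka].
    by rewrite !mxE eqxx mulr1n /= mulr_algl.
  by rewrite !mxE eq_sym (negbTE ka) mulr0n /= scale0r mul0r.
apply: spectralD IH => //; apply: covariant_intertwiner Hm => g.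
by rewrite scalar_mxC.
Qed.

Lemma spectral_elt_sum (I : Type) (r : seq I) (F : I -> A) :
  (forall i, spectral_elt (F i)) -> spectral_elt (\sum_(i <- r) F i).
Proof.
move=> HF; elim: r => [|i r IH]; first by rewrite big_nil; exact: spectral0.
by rewrite big_cons; exact: spectral_elt_add.
Qed.

Lemma spectral_elt_one_tens m n (T : 'M[C]_(m, n)) (x : 'cV[A]_n) :
  (forall j, spectral_elt (x j 0)) -> forall j, spectral_elt ((one_tens T *m x) j 0).
Proof.
move=> Hx j; rewrite mxE; apply: spectral_elt_sum => i.
by rewrite mxE /= mulr_algl; exact: spectral_elt_scale.
Qed.

(** Induction on the dimension: an irreducible [pi] is carried to its representative, any other is
    split by an invariant projection and its complement, both of smaller rank. *)
Lemma covariant_spectral (pi : urep R G) (x : 'cV[A]_(rdim pi)) :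
  covariant x -> forall j, spectral_elt (x j 0).
Proof.
have [n] := ubnP (rdim pi); elim: n => // n IH in pi x *.
rewrite ltnS => pin Hx j.
have [ipi|nipi] := pselect (irreducible pi).
  have [i [v [vv Hv] _]] := irr_surj Ghat ipi.
  have Hy : covariant (one_tens v *m x) by exact: covariant_intertwiner.
  have -> : x = one_tens (v ^t*) *m (one_tens v *m x).
    by rewrite mulmxA -one_tensM vv one_tens1 mul1mx.
  apply: spectral_elt_one_tens => k.
  (* [A2] consists of square matrices, so the column is repeated. *)
  pose m : 'M[A]_(rdim (irr i)) := \matrix_(a, b) (one_tens v *m x) a 0.
  have -> : (one_tens v *m x) k 0 = m k k + 0 by rewrite addr0 [RHS]mxE.
  apply: spectralD spectral0 => g; apply/matrixP => a b.
  rewrite [RHS]mxE -(Hy g) !mxE; apply: eq_bigr => c _; congr (_ * _).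
  by rewrite !mxE.
have [W [HW [W0 W1]]] : exists W : {vspace 'cV[C]_(rdim pi)},
    (forall g v, v \in W -> pi g *m v \in W) /\ (W <> 0%VS /\ W <> fullv).
  apply: contrapT => H; apply: nipi; split; first exact: leq_ltn_trans (ltn_ord j).
  move=> W HW; apply: contrapT => H'; apply: H; exists W; split => //.
  by apply/not_orP.
have [P [Pa PP HP P0 P1]] :=
  invariant_projection HW (introN eqP W0) (introN eqP W1).
have part Q : Q ^t* = Q -> Q *m Q = Q -> intertwiner pi pi Q -> Q != 1%:M ->
    forall j, spectral_elt ((one_tens Q *m x) j 0).
  move=> Qa QQ HQ /[dup] Q1; have [k [p [pp pQ kn]]] := projection_factor Qa QQ.
  move=> /kn {}kn; rewrite -pQ in HQ.
  have [rho [q [rk [qq Hq] qE]]] := subrep_exists pp HQ.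
  rewrite -pQ -qE one_tensM -mulmxA; apply: spectral_elt_one_tens.
  apply: IH; first by rewrite rk (leq_trans kn).
  by apply: covariant_intertwiner Hx; exact: intertwiner_adj.
have -> : x = one_tens P *m x + one_tens (1%:M - P) *m x.
  by rewrite -mulmxDl -one_tensD addrC subrK one_tens1 mul1mx.
rewrite mxE; apply: spectral_elt_add; first exact: part.
apply: part.
- by rewrite adjB adj1 Pa.
- by rewrite mulmxBl mul1mx mulmxBr mulmx1 PP subrr subr0.
- by move=> g; rewrite mulmxBl mulmxBr mulmx1 mul1mx HP.
- by rewrite -subr_eq0 addrAC subrr sub0r oppr_eq0.
Qed.

Context (cG : compact [set: G]).
Local Notation "f ** h" := (conv cG f h) (at level 40, left associativity).

Lemma act_ccontinuous (f : cfun R G) x : ccontinuous (fun g => cplx (f g) *: alpha g x).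
Proof.
move=> g e e0; have e2 : 0 < e / 2 by rewrite divr_gt0.
have c0 : 0 < cnorm x + 1 by rewrite ltr_wpDl // cnorm_ge0.
have d0 : 0 < `|f g| + 1 by rewrite ltr_wpDl.
have /cvgrPdist_lt/(_ _ (divr_gt0 e2 c0)) H1 := @cfun_continuous _ _ f g.
have /cvgrPdist_lt/(_ _ (divr_gt0 e2 d0)) H2 := act_continuous alpha x g.
apply: filterS2 H1 H2 => h h1 /=.
rewrite sub0r normrN [`|cnorm _|]ger0_norm ?cnorm_ge0 // => h2.
have -> : cplx (f h) *: alpha h x - cplx (f g) *: alpha g x =
   cplx (f h - f g) *: alpha h x + cplx (f g) *: (alpha h x - alpha g x).
  by rewrite cplxB scalerBl scalerBr addrA subrK.
rewrite (le_lt_trans (cnormD _ _)) // (splitr e) ltr_leD //.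
  rewrite cnormZr cnorm_act distrC.
  rewrite (@le_lt_trans _ _ (`|f g - f h| * (cnorm x + 1))) //.
    by rewrite ler_wpM2l // lerDl.
  by rewrite -ltr_pdivlMr.
rewrite cnormZr (@le_trans _ _ ((`|f g| + 1) * (e / 2 / (`|f g| + 1)))) //.
  by rewrite ler_pM ?cnorm_ge0 ?(ltW h2) // lerDl.
by rewrite mulrC divfK // gt_eqF.
Qed.

(* Integrating an orthonormal basis of [{f | f ** e = f}] along the orbit of [x]
   gives a covariant column for the orthogonal representation on that space. *)
Lemma conv_fixed_integral_spectral (e f : cfun R G) x y : f ** e = f ->
  integral (fun g => cplx (f g) *: alpha g x) y -> spectral_elt y.
Proof.
move=> fe Hy; have [rho [w [wE Hw]]] := conv_fixed_rep cG e.
have /choice[z Hz] i : exists z,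
    integral (fun g => cplx (w i g) *: alpha g x) z.
  by apply: integral_exists => //; exact: act_ccontinuous.
have -> : y = \sum_i cplx (dot f (w i)) *: z i.
  apply: (integral_unique cG Hy).
  have := integral_sum (index_enum _) (fun i => integral_scale (dot f (w i)) (Hz i)).
  congr integral; apply/funext => g; rewrite {2}(wE f fe) cfun_sumE cplx_sum scaler_suml.
  by apply: eq_bigr => i _; rewrite cfunZE cplxM scalerA.
apply: spectral_elt_sum => i; apply: spectral_elt_scale.
have zact g : exists r : 'M[R]_(rdim rho), rho g = map_mx cplx r /\
    forall j, alpha g (z j) = \sum_i cplx (r i j) *: z i.
  have [r [rE Hr]] := Hw g; exists r; split => // j.
  (* Translating the integrand by [g^-1] keeps the integral; [alpha g] then restores [alpha h x],
     leaving a left translate of [w j] to expand in the basis. *)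
  apply: (integral_unique cG (F := fun h => alpha g (cplx (w j (g^-1 * h)%g) *: alpha (g^-1 * h)%g x))).
    apply: (integral_map (phi := alpha g) (C := 1)).
    - by move=> c u; exact: linearZ_LR.
    - by move=> u; rewrite mul1r -[leRHS](cnorm_act alpha g).
    - exact: (integral_translate cG g^-1%g (Hz j)).
  have := integral_sum (index_enum _) (fun i => integral_scale (r i j) (Hz i)).
  congr integral; apply/funext => h.
  rewrite linearZ /= -actM mulVKg -ltransE Hr cfun_sumE cplx_sum scaler_suml.
  by apply: eq_bigr => k _; rewrite cfunZE cplxM scalerA.
have Hcov : covariant (\col_j z j).
  move=> g; have [r [rE Hr]] := zact g.
  (* [r] is real, so its transpose is the adjoint, hence the inverse, of [rho g]. *)
  have rr : rho g *m (map_mx cplx r)^T = 1%:M.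
    rewrite -[RHS](rep_adj2 rho g); congr (_ *m _); rewrite rE.
    by apply/matrixP => a b; rewrite !mxE conj_cplx.
  have -> : map_mx (alpha g) (\col_j z j) = one_tens (map_mx cplx r)^T *m \col_j z j.
    apply/matrixP => a b; rewrite !mxE Hr; apply: eq_bigr => k _.
    by rewrite !mxE /= mulr_algl.
  by rewrite mulmxA -one_tensM rr one_tens1 mul1mx.
by have := covariant_spectral Hcov i; rewrite mxE.
Qed.

(* With [phi = psi ** psi] supported where [alpha g x] is close to [x], the
   integral of [phi g *: alpha g x] is close to a multiple of [x]; replacing one
   factor [psi] by a sum [w] of [p.1 ** p.2] makes it spectral. *)
Lemma spectral_dense x (eps : R) : 0 < eps ->
  exists2 y, spectral_elt y & cnorm (x - y) <= eps.
Proof.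
(* Three parts are spent: [2 * d] because each factor of [phi] lets [x] move by [d], and [d] for
   replacing [psi] by [w]. *)
move=> eps0; pose d := eps / 4; have d0 : 0 < d by rewrite divr_gt0.
have epsE : eps = 4 * d by rewrite /d mulrC divfK // pnatr_eq0.
clearbody d.
have cbump : continuous (fun g => Num.max 0 (d - cnorm (alpha g x - x)) : R).
  move=> g; apply/cvgrPdist_lt => c c0.
  have /cvgrPdist_lt/(_ _ c0) := act_continuous alpha x g.
  apply: filterS => h; rewrite /= sub0r normrN ger0_norm ?cnorm_ge0 // => Hh.
  have : `|cnorm (alpha g x - x) - cnorm (alpha h x - x)| < c.
    rewrite (le_lt_trans (cnorm_dist_norm _ _)) // opprB addrA subrK cnormB //.
  move: (cnorm (alpha g x - x)) (cnorm (alpha h x - x)) => u v.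
  rewrite ltr_norml => /andP[? ?].
  by rewrite ltr_norml; case: (leP 0 (d - u)); case: (leP 0 (d - v)); move=> ? ?;
    apply/andP; split; lra.
pose psi : cfun R G := mk_cfun cbump.
have psi0 g : 0 <= psi g by rewrite /cfun_val /= le_max lexx.
have psiV g : psi g != 0 -> cnorm (alpha g x - x) <= d.
  apply: contraNT; rewrite -ltNge => h; apply/eqP/max_idPl.
  by rewrite subr_le0 ltW.
(* The isometry [alpha g] maps [alpha g^-1 x - x] to [x - alpha g x]. *)
have psiK : cinv psi = psi.
  apply: cfunP => g; rewrite cinvE; congr (Num.max 0 (d - _)).
  rewrite -[LHS](cnorm_act alpha g) raddfB /= -actM mulgV act1.
  by rewrite cnormB.
pose phi := psi ** psi.
have phi0 g : 0 <= phi g.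
  by rewrite /phi convE; apply: mean_ge0 => // u; apply: mulr_ge0; exact: psi0.
have phi1 : 0 < phi 1%g.
  rewrite /phi conv1E psiK; apply: (mean_gt0 cG (u0 := 1%g)).
    by move=> u; apply: mulr_ge0; exact: psi0.
  have : 0 < Num.max 0 (d - cnorm (alpha 1%g x - x)).
    by rewrite act1 subrr cnorm0 subr0 lt_max d0 orbT.
  by move=> p1; apply: mulr_gt0; exact: p1.
have Mphi : 0 < mean phi := mean_gt0 cG phi0 phi1.
have phiV g : cnorm (cplx (phi g) *: (alpha g x - x)) <= 2 * d * phi g.
  rewrite cnormZr ger0_norm // mulrC.
  have [->|phig] := eqVneq (phi g) 0; first by rewrite !mulr0.
  rewrite ler_wpM2r //.
  suff [t [t1 t2]] : exists t, psi t != 0 /\ psi (t^-1 * g)%g != 0.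
    have E : alpha g x = alpha t (alpha (t^-1 * g)%g x) by rewrite -actM mulVKg.
    rewrite E (le_trans (cnorm_dist _ (alpha t x) _)) // mulr_natl mulr2n lerD //.
      by rewrite -raddfB cnorm_act psiV.
    exact: psiV.
  apply: contrapT => H; move/eqP: phig; apply; rewrite /phi convE /dot.
  rewrite -[RHS](mean0 cG); congr mean; apply: cfunP => t.
  rewrite cmulE cinvE rtransE cfun0E; apply/eqP; rewrite mulf_eq0.
  apply: contrapT => /negP; rewrite negb_or => /andP[? ?]; apply: H.
  by exists t.
(* Chosen to make [cnorm x * mean (cabs u)] below at most [d * mean phi]; squares appear because
   [l2_small] bounds [norm2], and each [+ 1] keeps the denominator positive. *)
pose del := (d * mean phi) ^+ 2 / ((dot psi psi + 1) * (cnorm x + 1) ^+ 2).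
have x1 : 0 < cnorm x + 1 by rewrite ltr_wpDl // cnorm_ge0.
have dp : 0 < dot psi psi + 1 by apply: ltr_wpDl => //; exact: dot_ge0.
have del0 : 0 < del.
  apply: divr_gt0; first by apply: exprn_gt0; exact: mulr_gt0.
  by apply: mulr_gt0 => //; exact: exprn_gt0.
have [w [s [sid ws]] Hw] := idempotent_approximation cG psiK del0.
have intF (f : cfun R G) := integral_exists cG (act_ccontinuous f x).
have [y Hy] := intF phi; have [y' Hy'] := intF (psi ** w).
have sy' : spectral_elt y'.
  have /choice[z Hz] (p : cfun R G * cfun R G) := intF (psi ** (p.1 ** p.2)).
  have -> : y' = \sum_(p <- s) z p.
    apply: (integral_unique cG Hy').
    have := integral_sum s Hz; congr integral; apply/funext => g.
    rewrite ws -scaler_suml -cplx_sum; congr (cplx _ *: _).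
    rewrite -cfun_sumE; congr (cfun_val _ g).
    elim: s {sid ws} => [|p s IH]; rewrite ?big_nil ?big_cons.
      by rewrite -[X in _ = psi ** X](scale0r psi) convZr scale0r.
    by rewrite convDr IH.
  have Hsum (s' : seq (cfun R G * cfun R G)) : {subset s' <= s} ->
      spectral_elt (\sum_(p <- s') z p).
    elim: s' => [|p s' IH] ss; first by rewrite big_nil; exact: spectral0.
    rewrite big_cons; apply: spectral_elt_add.
      (* By idempotency of [p.2], the function [psi ** (p.1 ** p.2)] is fixed by [** p.2]. *)
      apply: (conv_fixed_integral_spectral (e := p.2)) (Hz p).
      by rewrite !conv_assoc sid // ss // mem_head.
    by apply: IH => q qs; apply: ss; rewrite inE qs orbT.
  exact: Hsum.
have yy' : cnorm (y - y') <= d * mean phi.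
  have Hd : integral (fun g => cplx ((psi ** (psi - w)) g) *: alpha g x) (y - y').
    have := integralD Hy (integral_scale (-1) Hy').
    have m1 : cplx (-1) = -1 :> C by rewrite -[-1]sub0r cplxB cplx0 cplx1 sub0r.
    rewrite m1 scaleN1r; congr integral; apply/funext => g.
    by rewrite scaleN1r -scalerBl -cplxB convBr.
  pose u := psi ** (psi - w).
  have h0 : cnorm (y - y') <= cnorm x * mean (cabs u).
    rewrite -meanZ //; apply: (integral_bound cG Hd) => g.
    by rewrite cnormZr cnorm_act cfunZE cabsE mulrC.
  apply: le_trans h0 _.
  have mu0 : 0 <= mean (cabs u) by apply: mean_ge0 => // g; rewrite cabsE.
  rewrite -(@ler_pXn2r _ 2) ?nnegrE ?mulr_ge0 ?cnorm_ge0 ?(ltW d0) ?(ltW Mphi) //.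
  have h1 := le_trans (mean_abs_dot cG u) (Hw psi).
  have h2 : cnorm x ^+ 2 <= (cnorm x + 1) ^+ 2.
    by rewrite ler_pXn2r ?nnegrE ?cnorm_ge0 ?(ltW x1) // lerDl.
  have h3 : (cnorm x * mean (cabs u)) ^+ 2 <= (cnorm x + 1) ^+ 2 * (del * dot psi psi).
    by rewrite exprMn ler_pM ?sqr_ge0.
  apply: le_trans h3 _.
  have -> : (d * mean phi) ^+ 2 = (cnorm x + 1) ^+ 2 * (del * (dot psi psi + 1)).
    by rewrite /del; field; rewrite !gt_eqF.
  apply: ler_wpM2l; first exact: sqr_ge0.
  by apply: ler_wpM2l; [exact: ltW|rewrite lerDl].
have yx : cnorm (y - cplx (mean phi) *: x) <= 2 * d * mean phi.
  have Hd : integral (fun g => cplx (phi g) *: (alpha g x - x)) (y - cplx (mean phi) *: x).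
    have Hx : integral (fun g => cplx (phi g) *: (- x)) (- (cplx (mean phi) *: x)).
      move=> c c0; exists [:: (phi, - x)].
      rewrite /simple /simple_mean big_seq1 /= scalerN subrr cnorm0 ltW //.
      by split => // g; rewrite big_seq1 /= scalerN subrr cnorm0 ltW.
    have := integralD Hy Hx; congr integral; apply/funext => g.
    by rewrite scalerBr scalerN.
  have := integral_bound cG (H := (2 * d) *: phi) Hd.
  by rewrite meanZ //; apply => g; rewrite cfunZE; exact: phiV.
exists (cplx (mean phi)^-1 *: y'); first exact: spectral_elt_scale.
have -> : x - cplx (mean phi)^-1 *: y' =
    cplx (mean phi)^-1 *: ((cplx (mean phi) *: x - y) + (y - y')).
  rewrite addrA subrK scalerBr scalerA -cplxM mulVf ?gt_eqF // cplx1 scale1r //.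
rewrite cnormZr ger0_norm ?invr_ge0 ?(ltW Mphi) // mulrC ler_pdivrMr //.
rewrite (le_trans (cnormD _ _)) // (cnormB (_ *: _)).
rewrite epsE.
have dm : 0 < d * mean phi by rewrite mulr_gt0.
move: yx yy' dm; rewrite -!mulrA; lra.
Qed.

End Covariance.

(** * From commuting entries to a commutative algebra *)

Section Commutativity.
Context {R : realType} {G : topGroupType} {A : cstarAlgType R}.
Context (alpha : cstar_system G A) (Ghat : irr_system R G) (s : @isometry_choice R G A Ghat).
Context (s_ndi : forall i, nondegenerate_isometry alpha (s i)).
Local Open Scope sesquilinear_scope.

(** The range projection of [s i] fixes the unitary that cleftness puts into [A2]; cancelling that
    unitary leaves 1. *)
Lemma cleft_unitary : cleft alpha Ghat -> forall i, s i *m adjmx (s i) = 1%:M.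
Proof.
move=> cl i; have [u [Hu _ uu]] := cl i; have [_ _ ssx] := s_ndi i.
by rewrite -[LHS]mulmx1 -uu mulmxA (ssx u Hu).
Qed.

(** The unitary that [m] picks up under [alpha g] cancels against that of [adjmx (s i)]. *)
Lemma isometry_adj_fixed (i : Ghat) (m : 'M[A]_(rdim (irr i))) a b : A2 alpha m ->
  fixed_points alpha ((adjmx (s i) *m m) a b).
Proof.
move=> Hm g; have [Hs _ _] := s_ndi i.
have actE x : A2 alpha (pi := irr i) x ->
    map_mx (alpha g) x = one_tens ((irr i g) ^t*) *m x.
  by move=> /(_ g) {2}<-; rewrite mulmxA -one_tensM rep_adj one_tens1 mul1mx.
have act_adj : map_mx (alpha g) (adjmx (s i)) = adjmx (map_mx (alpha g) (s i)).
  by apply/matrixP => c d; rewrite !mxE act_star.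
have : map_mx (alpha g) (adjmx (s i) *m m) = adjmx (s i) *m m.
  rewrite act_mulmx act_adj !actE // adjmxM one_tens_adj trmxCK.
  by rewrite -mulmxA (mulmxA (one_tens _)) -one_tensM rep_adj2 one_tens1 mul1mx.
by move=> /matrixP/(_ a b); rewrite mxE.
Qed.

Lemma spectral_comm :
  (forall b c, fixed_points alpha b -> fixed_points alpha c -> b * c = c * b) ->
  (forall i a b c, fixed_points alpha c -> s i a b * c = c * s i a b) ->
  (forall i j a b c d, s i a b * s j c d = s j c d * s i a b) ->
  forall x y, spectral_elt alpha Ghat x -> spectral_elt alpha Ghat y -> GRing.comm x y.
Proof.
move=> BB sB ss x y Hx Hy.
have entry (i : Ghat) (m : 'M[A]_(rdim (irr i))) a b : A2 alpha m ->
    m a b = \sum_k s i a k * (adjmx (s i) *m m) k b.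
  move=> Hm; have [_ _ ssx] := s_ndi i.
  by rewrite -[in LHS](ssx m Hm) -mulmxA mxE.
have ee (i : Ghat) (m : 'M[A]_(rdim (irr i))) a b (j : Ghat) (m' : 'M[A]_(rdim (irr j))) a' b' :
    A2 alpha m -> A2 alpha m' -> GRing.comm (m a b) (m' a' b').
  move=> Hm Hm'; rewrite (entry _ _ _ _ Hm) (entry _ _ _ _ Hm').
  apply: commr_sum => l _; apply: commr_sym; apply: commr_sum => k _.
  apply: commr_sym.
  have fk := isometry_adj_fixed k b Hm; have fl := isometry_adj_fixed l b' Hm'.
  apply: commrM; apply: commr_sym; apply: commrM.
  - exact: ss.
  - exact: sB.
  - by apply: commr_sym; exact: sB.
  - exact: BB.
have ey (i : Ghat) (m : 'M[A]_(rdim (irr i))) a b : A2 alpha m -> GRing.comm (m a b) y.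
  move=> Hm; elim: Hy => [|j m' a' b' {}y Hm' _ IH]; first exact: commr0.
  by apply: commrD => //; exact: ee.
elim: Hx => [|i m a b {}x Hm _ IH]; first exact: commr_sym (commr0 _).
apply: commr_sym; apply: commrD; last exact: commr_sym.
by apply: commr_sym; exact: ey.
Qed.

Lemma comm_dense (cG : compact [set: G]) (x : A) :
  (forall y, spectral_elt alpha Ghat y -> GRing.comm x y) ->
  forall y, GRing.comm x y.
Proof.
move=> Hx y; apply/eqP; rewrite -subr_eq0; apply/eqP; apply: cnorm_le0.
(* The commutator with [y - z] has two products, each allowed [e / 2]. *)
apply/ler_addgt0Pr => e e0; pose c := 2 * (cnorm x + 1).
have x1 : 0 < cnorm x + 1 by rewrite ltr_wpDl // cnorm_ge0.
have c0 : 0 < c by rewrite mulr_gt0.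
have [z Hz yz] := spectral_dense alpha Ghat cG y (divr_gt0 e0 c0).
have -> : x * y - y * x = x * (y - z) - (y - z) * x.
  by rewrite mulrBr mulrBl (Hx z Hz) opprB addrA subrK.
rewrite add0r (le_trans (cnormD _ _)) // cnormN.
have yz0 := cnorm_ge0 (y - z).
have h : cnorm x * cnorm (y - z) <= (cnorm x + 1) * (e / c).
  by rewrite ler_pM ?cnorm_ge0 // lerDl.
have -> : e = (cnorm x + 1) * (e / c) + (cnorm x + 1) * (e / c).
  by rewrite /c; field; rewrite gt_eqF.
rewrite lerD // (le_trans (cnormM _ _)) // mulrC //.
Qed.

End Commutativity.

Theorem corollary5p10 (R : realType) (G : topGroupType) (A : cstarAlgType R)
    (alpha : cstar_system G A) (Ghat : irr_system R G)
    (gamma : forall i : Ghat, A -> 'M[A]_(rdim (irr i)))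
    (omega : forall i j : Ghat, 'M[A]_(rdim (irr i) * rdim (irr j))) :
  compact [set: G] -> hausdorff_space G ->
  cleft alpha Ghat ->
  (forall b c : A, fixed_points alpha b -> fixed_points alpha c ->
     b * c = c * b) ->
  associated_factor_system alpha gamma omega ->
  ((forall x y : A, x * y = y * x) <->
   (forall (i j : Ghat) (b : A), fixed_points alpha b ->
      gamma i b = b%:M /\ omega j i = tensor_flip (omega i j))).
Proof.
move=> cG _ cl BB [s [s_ndi _ gammaE omegaE]].
have scalarE (b : A) n (x : 'M[A]_n) a c : (b%:M *m x) a c = b * x a c.
  by rewrite mul_scalar_mx mxE.
have scalarEr (b : A) n (x : 'M[A]_n) a c : (x *m b%:M) a c = x a c * b.
  rewrite mxE (bigD1 c) //= big1 ?addr0 => [|k kc]; first by rewrite mxE eqxx mulr1n.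
  by rewrite mxE (negbTE kc) mulr0n mulr0.
(* Uniqueness lets [tensor_flip (omega i j)] and [omega j i] share one [t]; only their second
   factors can then differ. *)
have omega_flip i j : exists t, [/\ extends_choice s (pi := tensor_rep (irr i) (irr j)) t,
    tensor_flip (omega i j) = adjmx (tensor_flip t) *m tensor_flip (s i *t s j)
    & omega j i = adjmx (tensor_flip t) *m (s j *t s i)].
  have [t Ht tE] := omegaE i j; have [t' Ht' tE'] := omegaE j i.
  exists t; split => //.
    by rewrite tE -mulmxA legs_mul tensor_flipM tensor_flip_adj.
  rewrite tE' -mulmxA legs_mul; congr (adjmx _ *m _).
  exact: extends_choice_unique Ht' (extends_choice_flip Ht).
split=> [comm i j b Hb|H].
  have [_ ss _] := s_ndi i; split.
    rewrite gammaE // -mulmxA.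
    have -> : b%:M *m s i = s i *m b%:M.
      by apply/matrixP => a c; rewrite scalarE scalarEr comm.
    by rewrite mulmxA ss mul1mx.
  have [t [_ -> ->]] := omega_flip i j; congr (_ *m _); apply/esym.
  by apply/tensor_flip_tens => *; exact: comm.
have su := cleft_unitary s_ndi cl.
have sB i a b c : fixed_points alpha c -> s i a b * c = c * s i a b.
  move=> Hc; have [gc _] := H i i c Hc.
  have : s i *m gamma i c = c%:M *m s i by rewrite gammaE // !mulmxA su mul1mx.
  by rewrite gc => /matrixP/(_ a b); rewrite scalarE scalarEr.
(* The symmetry of [omega] sits under the quantifier over fixed points; [1] instantiates it. *)
have f1 : fixed_points alpha 1 by move=> g; exact: rmorph1.
have ss i j a b c d : s i a b * s j c d = s j c d * s i a b.
  have [t [Ht E1 E2]] := omega_flip i j; have [_ E] := H i j 1 f1.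
  move: E; rewrite E1 E2 => /(congr1 (mulmx (tensor_flip t))).
  rewrite !mulmxA (extends_choice_unitary su (extends_choice_flip Ht)) !mul1mx.
  by move=> /esym/tensor_flip_tens; exact.
have sp := spectral_comm s_ndi BB sB ss.
pose dense := @comm_dense R G A alpha Ghat cG.
(* Density is used once for each of the two arguments. *)
move=> x; apply: (dense) => y Hy; apply: commr_sym.
by apply: (dense) => z Hz; exact: sp.
Qed.
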